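(* Let $\rho_0\in \mathrm{L}^\infty\cap \mathrm{BV}(\mathbb{R};\mathbb{R}_+)$ and $T>0$. If the CFL condition $$\frac{\Delta t}{\Delta x}\le \min\left\{\frac{8-27\alpha}{27\|\partial_\rho f\|},\ \frac{2}{27\|\partial_\rho f\|},\ \frac{\alpha}{\|\partial_\rho f\|}\right\}$$ holds, then there exists a constant $\kappa$, independent of the mesh size $\Delta x$ (with $\lambda=\Delta t/\Delta x$ fixed), such that the approximate solutions $\rho_\Delta$ generated by the MUSCL-Hancock scheme described in the context satisfy $$\|\rho_\Delta(t_1,\cdot)-\rho_\Delta(t_2,\cdot)\|_{\mathrm{L}^1(\mathbb{R})}\le \kappa\,\big(|t_1-t_2|+\Delta t\big)\qquad\text{for any } t_1,t_2\in[0,T].$$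
   Context: Notation: $\mathbb{R}_+=[0,\infty)$; $\|\cdot\|$ denotes the $\mathrm{L}^\infty$ norm (for $\partial_\rho f$ over $\mathbb{R}\times\mathbb{R}$); $\mathrm{BV}(\mathbb{R})$ is the space of $\mathrm{L}^1(\mathbb{R})$ functions of bounded total variation. Problem: $\partial_t\rho+\partial_x f(\rho,A(t,x))=0$ on $(0,\infty)\times\mathbb{R}$, $\rho(0,x)=\rho_0(x)$, where $A(t,x)=\int_{\mathbb{R}}\mu(x-y)\rho(t,y)\,dy$. Standing hypotheses on $f=f(\rho,A):\mathbb{R}\times\mathbb{R}\to\mathbb{R}$ and $\mu:\mathbb{R}\to\mathbb{R}$: $f\in \mathrm{C}^2(\mathbb{R}\times\mathbb{R};\mathbb{R})$, $\partial_\rho f\in \mathrm{L}^\infty(\mathbb{R}\times\mathbb{R})$, $f(0,A)=0$ for all $A\in\mathbb{R}$; there is $M>0$ with $|\partial_A f(\rho,A)|,\ |\partial^2_{AA}f(\rho,A)|\le M|\rho|$ for all $\rho,A$; $\partial_\rho f\in \mathrm{W}^{1,\infty}(\mathbb{R}\times\mathbb{R})$; $\mu\in \mathrm{C}_c^2\cap \mathrm{W}^{2,\infty}(\mathbb{R};\mathbb{R})$. Scheme. Fix $\theta\in[0,\tfrac12]$, $\alpha\in(0,\tfrac{8}{27})$, $\Delta x,\Delta t>0$, $\lambda=\Delta t/\Delta x$, $x_j=j\Delta x$, $x_{j+1/2}=x_j+\Delta x/2$, $t^n=n\Delta t$, $\mu_j=\mu(j\Delta x)$ ($j\in\mathbb{Z}$,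 $n\in\mathbb{N}\cup\{0\}$). Set $\rho^0_j=\frac1{\Delta x}\int_{x_{j-1/2}}^{x_{j+1/2}}\rho_0(x)\,dx$. Given $(\rho^n_j)_{j\in\mathbb{Z}}$: (1) Slopes: $\sigma^n_j=2\theta\,\mathrm{minmod}\big(\rho^n_j-\rho^n_{j-1},\ \tfrac12(\rho^n_{j+1}-\rho^n_{j-1}),\ \rho^n_{j+1}-\rho^n_j\big)$, where minmod of several numbers is $0$ unless all are nonzero with the same sign, in which case it is the one of smallest absolute value. Face values: $\rho^{n,-}_{j+1/2}=\rho^n_j+\tfrac12\sigma^n_j$, $\rho^{n,+}_{j-1/2}=\rho^n_j-\tfrac12\sigma^n_j$. (2) Convolutions: $A^n_j=\Delta x\sum_{l\in\mathbb{Z}}\mu_{j-l}\rho^n_l$, $s^n_j=\theta(A^n_{j+1}-A^n_{j-1})$, $A^{n,-}_{j+1/2}=A^n_j+\tfrac12 s^n_j$, $A^{n,+}_{j-1/2}=A^n_j-\tfrac12 s^n_j$. (3) Mid-time values: $\rho^{n+1/2,-}_{j+1/2}=\rho^{n,-}_{j+1/2}-\tfrac{\lambda}{2}\delta^n_j$ and $\rho^{n+1/2,+}_{j-1/2}=\rho^{n,+}_{j-1/2}-\tfrac{\lambda}{2}\delta^n_j$, with $\delta^n_j=f(\rho^{n,-}_{j+1/2},A^{n,-}_{j+1/2})-f(\rho^{n,+}_{j-1/2},A^{n,+}_{j-1/2})$. (4) Mid-time convolution: $A^{n+1/2}_{j+1/2}=\tfrac{\Delta x}{2}\sum_{l\in\mathbb{Z}}\big[\mu_{j+1-l}\,\rho^{n+1/2,+}_{l-1/2}+\mu_{j-l}\,\rho^{n+1/2,-}_{l+1/2}\big]$.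 (5) Update: $\rho^{n+1}_j=\rho^n_j-\lambda\big[F^{n+1/2}_{j+1/2}-F^{n+1/2}_{j-1/2}\big]$, where $F^{n+1/2}_{j+1/2}=F(\rho^{n+1/2,-}_{j+1/2},\rho^{n+1/2,+}_{j+1/2},A^{n+1/2}_{j+1/2})$ and $F(u,v,A)=\tfrac12\big(f(u,A)+f(v,A)\big)-\tfrac{\alpha}{2\lambda}(v-u)$. Approximate solution: $\rho_\Delta(t,x)=\rho^n_j$ for $(t,x)\in[t^n,t^{n+1})\times[x_{j-1/2},x_{j+1/2})$, $n\in\mathbb{N}\cup\{0\}$, $j\in\mathbb{Z}$. In the CFL condition, quotients by $\|\partial_\rho f\|$ are read as $+\infty$ if $\|\partial_\rho f\|=0$. *)

(* Defs.v *)
From HB Require Import structures.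
From mathcomp Require Export all_boot all_order all_algebra.
From mathcomp Require Export all_classical all_reals all_analysis.

Set Implicit Arguments.
Unset Strict Implicit.
Unset Printing Implicit Defensive.
Import Order.TTheory GRing.Theory Num.Theory.
Import numFieldNormedType.Exports.

Local Open Scope classical_set_scope.
Local Open Scope ring_scope.

Section FunctionSpaces.
Variable R : realType.
Implicit Types (g : R -> R -> R) (h u : R -> R).

Definition d_rho g : R -> R -> R := fun r a => derive1 (fun z => g z a) r.
Definition d_A g : R -> R -> R := fun r a => derive1 (fun z => g r z) a.

Definition continuous2 g := continuous (fun p : R * R => g p.1 p.2).

Definition C1_plane g :=
  [/\ continuous2 g,
      forall r a, derivable (fun z => g z a) r 1,
      forall r a, derivable (fun z => g r z) a 1,
      continuous2 (d_rho g)
    & continuous2 (d_A g)].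

Definition C2_plane g :=
  [/\ C1_plane g, C1_plane (d_rho g) & C1_plane (d_A g)].

Definition C2_line h :=
  [/\ forall x, derivable h x 1,
      forall x, derivable (derive1 h) x 1
    & continuous (derive1n 2 h)].

Definition compact_support h := compact (closure [set x | h x != 0]).

Definition lebesgue_plane :
    {measure set (measurableTypeR R * measurableTypeR R)%type -> \bar R} :=
  (@lebesgue_measure R \x @lebesgue_measure R)%E.

Definition Linf_norm_plane g : \bar R :=
  ('N[lebesgue_plane]_+oo[(fun p => (g p.1 p.2)%:E)])%E.

Definition Linf_plane g :=
  (fun p : R * R => g p.1 p.2) \in Lfun lebesgue_plane +oo%E.

(* The weak derivatives in the definition of W^{k,oo} are the classical ones
   here, since the next two predicates are only used for g of class C^1 and
   h of class C^2. *)
Definition W1inf_plane g :=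
  [/\ Linf_plane g, Linf_plane (d_rho g) & Linf_plane (d_A g)].

Definition W2inf_line h :=
  forall k, (k <= 2)%N -> derive1n k h \in Lfun (@lebesgue_measure R) +oo%E.

Definition TV_line u : \bar R :=
  ereal_sup [set total_variation ab.1 ab.2 u
            | ab in [set ab : R * R | ab.1 <= ab.2]].

(* Elements of L^1 are classes modulo a.e. equality: the variation of a class
   is the least pointwise variation of its representatives. *)
Definition ess_TV_line u : \bar R :=
  ereal_inf [set TV_line v | v in [set v | v = u %[ae @lebesgue_measure R]]].

Definition BV_line u :=
  u \in Lfun (@lebesgue_measure R) 1%E /\ (ess_TV_line u < +oo)%E.

End FunctionSpaces.

Section Scheme.
Variable R : realType.

Definition minmod (a b c : R) : R :=
  if [&& 0 < a, 0 < b & 0 < c] then Num.min a (Num.min b c)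
  else if [&& a < 0, b < 0 & c < 0] then Num.max a (Num.max b c)
  else 0.

Variables (f : R -> R -> R) (mu : R -> R) (theta alpha dx dt : R).

Let lambda : R := dt / dx.

Definition mesh_point (j : int) : R := j%:~R * dx.

Definition mu_mesh (j : int) : R := mu (mesh_point j).

Definition cell (j : int) : set R :=
  `[mesh_point j - dx / 2, mesh_point j + dx / 2[.

Definition cell_average (rho0 : R -> R) (j : int) : R :=
  dx^-1 * \int[@lebesgue_measure R]_(x in cell j) rho0 x.

(* One time step, from the values rho = rho^n. Quantities living at the
   interfaces are indexed by the cell j they are computed in: [_minus] is the
   value at x_{j+1/2}, [_plus] the value at x_{j-1/2}. The sums over int have
   finitely many nonzero terms as soon as mu has compact support. *)
Section Step.
Variable rho : int -> R.

Definition slope (j : int) : R :=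
  2 * theta * minmod (rho j - rho (j - 1))
                     ((rho (j + 1) - rho (j - 1)) / 2)
                     (rho (j + 1) - rho j).

Definition rho_minus (j : int) : R := rho j + slope j / 2.
Definition rho_plus (j : int) : R := rho j - slope j / 2.

Definition conv (j : int) : R :=
  dx * \sum_(l \in [set: int]) (mu_mesh (j - l) * rho l).

Definition conv_slope (j : int) : R := theta * (conv (j + 1) - conv (j - 1)).

Definition conv_minus (j : int) : R := conv j + conv_slope j / 2.
Definition conv_plus (j : int) : R := conv j - conv_slope j / 2.

Definition delta (j : int) : R :=
  f (rho_minus j) (conv_minus j) - f (rho_plus j) (conv_plus j).

Definition rho_mid_minus (j : int) : R := rho_minus j - lambda / 2 * delta j.
Definition rho_mid_plus (j : int) : R := rho_plus j - lambda / 2 * delta j.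

(* value at x_{j+1/2} *)
Definition conv_mid (j : int) : R :=
  dx / 2 * \sum_(l \in [set: int])
    (mu_mesh (j + 1 - l) * rho_mid_plus l + mu_mesh (j - l) * rho_mid_minus l).

Definition numerical_flux (u v a : R) : R :=
  (f u a + f v a) / 2 - alpha / (2 * lambda) * (v - u).

(* value at x_{j+1/2} *)
Definition flux_mid (j : int) : R :=
  numerical_flux (rho_mid_minus j) (rho_mid_plus (j + 1)) (conv_mid j).

Definition step (j : int) : R :=
  rho j - lambda * (flux_mid j - flux_mid (j - 1)).

End Step.

Definition scheme (rho0 : R -> R) (n : nat) : int -> R :=
  iter n step (cell_average rho0).

(* For t >= 0, the indices below are the n and j such that
   t^n <= t < t^{n+1} and x_{j-1/2} <= x < x_{j+1/2}. *)
Definition approx_solution (rho0 : R -> R) (t x : R) : R :=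
  scheme rho0 (Num.truncn (t / dt)) (Num.floor (x / dx + 2^-1)).

End Scheme.

(* Main.v *)
Require Import Defs.
From mathcomp Require Import ring lra zify ess_sup_inf measurable_realfun.
Import Order.TTheory GRing.Theory Num.Theory.
Import numFieldNormedType.Exports.
Local Open Scope classical_set_scope.
Local Open Scope ring_scope.
Set Implicit Arguments.
Unset Strict Implicit.
Unset Printing Implicit Defensive.

(** The estimate rests on three bounds for the discrete solutions that are
uniform in the mesh: positivity, conservation of the mass in l^1, and a bound
on the total variation over [0, T]. Given these, one time step moves the
solution in L^1 by O(dt), because the flux difference across a cell is
controlled by the local jumps and by the O(dx) variation of the nonlocal term;
summing over the time steps between t1 and t2 gives the result.

The flux is viscous enough ([flux_harten]) for its difference to split as
p * (u - u') - q * (v - v') with p, q in [0, 4/27]. Comparing with the zero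
state, at which f vanishes, each cell gives a nonnegative part of its content
to each neighbour and keeps the rest: this is positivity and conservation of
mass ([step_positive_mass]). Comparing neighbouring cells, the minmod limiter
makes the reconstructed jumps multiples, with factors in [0, 2], of the jump of
the cell values ([mid_diff]), so that the jumps obey the same exchange law, up to
errors due to the dependence of f on the nonlocal term. Both arguments end
in the same summation lemma [abs_sum_le_redistribute].

The errors are differences of increments of f in its second argument.
They are of the size dx * (|jump| + dx * rho), since such a difference is
bounded through the mixed derivative when the first argument changes, and
through the factor |rho| in the bounds on the derivatives in A together with
second differences of the convolution when the second argument changes
([f_increment]). As dx * (sum of rho) is the mass, one step multiplies the
variation by 1 + O(dt) and adds O(dt) ([step_variation]), and a discrete
Gronwall argument ([iter_variation]) concludes.

On the analytic side, essential suprema of continuous functions bound them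
pointwise, which gives the Lipschitz constants of f and of mu from the
hypotheses. Translating all cells to the one at the origin bounds the variation
of the cell averages by that of any representative of the initial datum. *)

(** * Absolute sums over the integers *)
Definition int_window (j : int) (n : nat) : seq int :=
  [seq j - n%:Z + k%:Z | k <- iota 0 (n + n).+1].

Lemma int_window_uniq j n : uniq (int_window j n).
Proof. by rewrite map_inj_uniq ?iota_uniq// => k l /addrI[]. Qed.

Lemma mem_int_window (j l : int) n :
  (absz (l - j)%R <= n)%N -> l \in int_window j n.
Proof.
move=> lj; apply/mapP; exists (absz (l - j + n%:Z)%R); last by lia.
by rewrite mem_iota; lia.
Qed.

Section AbsoluteSums.
Variable R : realType.
Implicit Types (x y w : int -> R) (C D : R).

(** An l^1 bound stated on finite sums only: the partial sums over duplicate-free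
sequences of indices are stable under shifts, and no limit is involved. *)
Definition abs_sum_le x C :=
  forall s : seq int, uniq s -> \sum_(j <- s) `|x j| <= C.

Lemma abs_sum_le_ge0 x C : abs_sum_le x C -> 0 <= C.
Proof. by move/(_ [::] isT); rewrite big_nil. Qed.

Lemma abs_sum_le_dom x y C :
  (forall j, `|y j| <= `|x j|) -> abs_sum_le x C -> abs_sum_le y C.
Proof.
move=> yx xC s us; apply: le_trans (xC s us).
by apply: ler_sum => j _; exact: yx.
Qed.

Lemma abs_sum_le_weaken x C D : C <= D -> abs_sum_le x C -> abs_sum_le x D.
Proof. by move=> CD xC s us; exact: le_trans (xC s us) CD. Qed.

Lemma abs_sum_leD x y C D : abs_sum_le x C -> abs_sum_le y D ->
  abs_sum_le (fun j => x j + y j) (C + D).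
Proof.
move=> xC yD s us; apply: le_trans (lerD (xC s us) (yD s us)).
by rewrite -big_split; apply: ler_sum => j _; exact: ler_normD.
Qed.

Lemma abs_sum_le_abs x C : abs_sum_le x C -> abs_sum_le (fun j => `|x j|) C.
Proof. by apply: abs_sum_le_dom => j; rewrite normr_id. Qed.

Lemma abs_sum_leZ a x C : 0 <= a -> abs_sum_le x C ->
  abs_sum_le (fun j => a * x j) (a * C).
Proof.
move=> a0 xC s us.
under eq_bigr do rewrite normrM (ger0_norm a0).
by rewrite -mulr_sumr ler_wpM2l// xC.
Qed.

Lemma abs_sum_le_shift k x C : abs_sum_le x C ->
  abs_sum_le (fun j => x (j + k)) C.
Proof.
move=> xC s us.
rewrite -(big_map (fun j => j + k) predT (fun j => `|x j|)).
by apply: xC; rewrite map_inj_uniq//; exact: addIr.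
Qed.

Lemma ler_sum_subset (s t : seq int) w : uniq s -> uniq t ->
  {subset s <= t} -> (forall j, 0 <= w j) ->
  \sum_(j <- s) w j <= \sum_(j <- t) w j.
Proof.
move=> us ut st w_ge0.
rewrite [leRHS](bigID (mem s))/= -[leLHS]addr0 lerD ?sumr_ge0//.
rewrite -[leRHS]big_filter (perm_big [seq j <- t | j \in s])//.
apply: uniq_perm => //; first exact: filter_uniq.
by move=> j; rewrite mem_filter andb_idr//; exact: st.
Qed.

(** The content [x j] of a cell splits into a part that stays and two parts that
go to the neighbours; no mass is created. Mass conservation and the decrease of
the variation are both instances, for the cell values and for the jumps. *)
Lemma abs_sum_le_redistribute x y w0 w1 w2 C :
  (forall j, [/\ 0 <= w0 j, 0 <= w1 j & 0 <= w2 j]) ->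
  (forall j, w0 j + w1 j + w2 j = `|x j|) ->
  (forall j, `|y j| <= w0 j + w1 (j - 1) + w2 (j + 1)) ->
  abs_sum_le x C -> abs_sum_le y C.
Proof.
move=> w_ge0 wx yw xC s us.
(* A finite set of cells is compared with the set of all cells that feed it. *)
pose u := undup (s ++ [seq j - 1 | j <- s] ++ [seq j + 1 | j <- s]).
have uu : uniq u by exact: undup_uniq.
apply: le_trans (xC u uu).
under [leRHS]eq_bigr do rewrite -wx.
apply: le_trans (ler_sum _ (fun j _ => yw j)) _.
rewrite !big_split/= !lerD//.
- apply: ler_sum_subset => //; last by move=> j; case: (w_ge0 j).
  by move=> j js; rewrite mem_undup mem_cat js.
- rewrite -(big_map (fun j => j - 1) predT w1); apply: ler_sum_subset => //.
  + by rewrite map_inj_uniq//; exact: addIr.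
  + by move=> j js; rewrite mem_undup !mem_cat js orbT.
  + by move=> j; case: (w_ge0 j).
- rewrite -(big_map (fun j => j + 1) predT w2); apply: ler_sum_subset => //.
  + by rewrite map_inj_uniq//; exact: addIr.
  + by move=> j js; rewrite mem_undup !mem_cat js !orbT.
  + by move=> j; case: (w_ge0 j).
Qed.

(** The finite support of a kernel turns the convolution sums into sums over a
fixed finite sequence, where linearity applies. *)
Lemma fsum_window (D : seq int) (a x : int -> R) :
  uniq D -> (forall l, l \notin D -> a l = 0) ->
  \sum_(l \in [set: int]) (a l * x l) = \sum_(l <- D) a l * x l.
Proof.
move=> uD aD; rewrite (fsbigE D)//; last by move=> l _ /aD ->; rewrite mul0r.
by rewrite big_mkcond/=; apply: eq_bigr => l _; rewrite in_setT.
Qed.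

Lemma norm_sum_kernel_le (D : seq int) (a x : int -> R) (b C : R) :
  uniq D -> 0 <= b -> (forall l, `|a l| <= b) -> abs_sum_le x C ->
  `|\sum_(l <- D) a l * x l| <= b * C.
Proof.
move=> uD b0 ab xC.
apply: le_trans (ler_norm_sum _ _ _) _.
apply: (@le_trans _ _ (\sum_(l <- D) b * `|x l|)).
  by apply: ler_sum => l _; rewrite normrM ler_wpM2r.
by rewrite -mulr_sumr ler_wpM2l// xC.
Qed.

End AbsoluteSums.

(** * Pointwise bounds and Lipschitz estimates *)

Section PointwiseBounds.
Variable R : realType.
Implicit Types (g h : R -> R) (C D : R).

(** If a value exceeded the essential supremum, then so would all the values on a
neighbourhood of positive measure. *)
Lemma Linf_norm_pointwise (d : measure_display) (T : measurableType d)
    (nu : {measure set T -> \bar R}) (g : T -> R) (p : T) C :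
  (forall eps, 0 < eps -> exists U : set T,
     [/\ measurable U, (0 < nu U)%E &
       forall x, U x -> `|g p| - eps < `|g x|]) ->
  ('N[nu]_+oo[(fun x => (g x)%:E)] <= C%:E)%E -> `|g p| <= C.
Proof.
move=> near_p gC; rewrite leNgt; apply/negP => Cg.
have [|U [mU U0 Ug]] := near_p (`|g p| - C); first by rewrite subr_gt0.
move: gC; rewrite unlock ifT; last first.
  apply: lt_le_trans U0 _; apply: le_measure => //; exact: mem_set.
move/ess_supP => [N [mN N0 Nsub]].
have : (nu U <= nu N)%E.
  apply: le_measure; rewrite ?inE//; move=> x Ux; apply: Nsub => /=.
  apply/negP; rewrite -ltNge lte_fin.
  by have := Ug x Ux; rewrite subKr.
by rewrite N0 leNgt U0.
Qed.

Lemma Linf_line_pointwise h C : continuous h ->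
  ('N[@lebesgue_measure R]_+oo[(fun x => (h x)%:E)] <= C%:E)%E ->
  forall x, `|h x| <= C.
Proof.
move=> ch hC x; apply: Linf_norm_pointwise hC => eps eps0.
have /cvgr_dist_lt/(_ _ eps0) := ch x.
move=> /nbhs_ballP[d /= d0 hd].
exists [set` `]x - d, x + d[]; split => //.
  rewrite lebesgue_measure_itv/= lte_fin ifT; first by rewrite lte_fin; lra.
  by lra.
move=> y; rewrite /= in_itv/= => /andP[y1 y2].
have yd : `|h x - h y| < eps by apply: hd; rewrite /ball/= ltr_norml; lra.
by have := ler_dist_dist (h x) (h y); have := ler_norm (`|h x| - `|h y|); lra.
Qed.

Lemma Linf_plane_pointwise (g : R -> R -> R) C : continuous2 g ->
  (Linf_norm_plane g <= C%:E)%E -> forall r a, `|g r a| <= C.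
Proof.
move=> cg gC r a.
apply: (@Linf_norm_pointwise _ _ (lebesgue_plane R) (fun p => g p.1 p.2) (r, a)
  C _ gC) => eps eps0.
have /cvgr_dist_lt/(_ _ eps0) := cg (r, a).
move=> /nbhs_ballP[d /= d0 hd].
exists ([set` `]r - d, r + d[] `*` [set` `]a - d, a + d[]); split => //.
- exact: measurableX.
- rewrite /lebesgue_plane product_measure1E//.
  have m x : (0 < @lebesgue_measure R [set` `](x - d)%R, (x + d)%R[])%E.
    rewrite lebesgue_measure_itv/= lte_fin ifT; first by rewrite lte_fin; lra.
    by lra.
  by apply: mule_gt0; exact: m.
move=> [y z] [/=]; rewrite !in_itv/= => /andP[y1 y2] /andP[z1 z2].
have yd : `|g r a - g y z| < eps.
  by apply: (hd (y, z)); split; rewrite /ball/= ltr_norml; lra.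
by have := ler_dist_dist (g r a) (g y z);
  have := ler_norm (`|g r a| - `|g y z|); lra.
Qed.

Lemma lipschitz_of_derive1 h C : (forall x, derivable h x 1) ->
  (forall x, `|derive1 h x| <= C) -> forall x y, `|h x - h y| <= C * `|x - y|.
Proof.
move=> dh hC x y; wlog yx : x y / y <= x.
  by move=> H; have [/H//|/ltW/H] := leP y x; rewrite distrC [`|y - x|]distrC.
have [c _ ->] : exists2 c, c \in `[y, x] & h x - h y = derive1 h c * (x - y).
  apply: MVT_segment => // [z _|].
    by rewrite derive1E; exact: derivableP.
  exact: derivable_within_continuous.
by rewrite normrM ler_wpM2r.
Qed.

Lemma mean_value h : (forall x, derivable h x 1) -> forall x y,
  exists2 c, `|c - x| <= `|x - y| & h x - h y = derive1 h c * (x - y).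
Proof.
move=> dh x y.
have mvt (s t : R) : s <= t ->
    exists2 c, c \in `[s, t] & h t - h s = derive1 h c * (t - s).
  move=> st; apply: MVT_segment => // [z _|].
    by rewrite derive1E; exact: derivableP.
  exact: derivable_within_continuous.
have [yx|/ltW xy] := leP y x.
  have [c ci e] := mvt _ _ yx; exists c => //.
  move: ci; rewrite in_itv/= => /andP[c1 c2].
  by rewrite distrC !ger0_norm ?subr_ge0//; lra.
have [c ci e] := mvt _ _ xy; exists c; last by rewrite -opprB e; ring.
move: ci; rewrite in_itv/= => /andP[c1 c2].
by rewrite [`|x - y|]distrC !ger0_norm ?subr_ge0//; lra.
Qed.

End PointwiseBounds.

Section Regularity.
Variable R : realType.
Implicit Types (h mu : R -> R) (f g : R -> R -> R).

(** Each increment of [h] is a derivative times a length; the difference of the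
lengths costs C, and the two derivatives are taken at points whose distance is
at most the sum of the two lengths and of the distance between [a] and [a'].
In the scheme all these lengths are O(dx). *)
Lemma second_difference h C D : (forall x, derivable h x 1) ->
  (forall x, `|derive1 h x| <= C) ->
  (forall x y, `|derive1 h x - derive1 h y| <= D * `|x - y|) ->
  forall a b a' b', `|(h a - h b) - (h a' - h b')| <=
    C * `|(a - b) - (a' - b')|
    + D * `|a' - b'| * (`|a - b| + `|a' - b'| + `|a - a'|).
Proof.
move=> dh hC hD a b a' b'.
have [x xa ->] := mean_value dh a b; have [y ya ->] := mean_value dh a' b'.
have D0 : 0 <= D.
  by have := le_trans (normr_ge0 _) (hD 1 0); rewrite subr0 normr1 mulr1.
rewrite [X in `|X|](_ : _ = derive1 h x * ((a - b) - (a' - b'))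
    + (derive1 h x - derive1 h y) * (a' - b')); last by ring.
apply: le_trans (ler_normD _ _) _; rewrite !normrM; apply: lerD.
  by rewrite ler_wpM2r.
rewrite mulrAC ler_wpM2r//; apply: le_trans (hD x y) _.
rewrite ler_wpM2l//.
have -> : x - y = (x - a) + (a - a') + (a' - y) by ring.
apply: le_trans (ler_normD _ _) _.
apply: le_trans (lerD (ler_normD _ _) (lexx _)) _.
by rewrite [`|a' - y|]distrC; lra.
Qed.

Lemma Linf_plane_norm_fin g : Linf_plane g ->
  Linf_norm_plane g = (fine (Linf_norm_plane g))%:E.
Proof.
move=> /sub_Lfun_finLfun/set_mem; rewrite /finite_norm /= => gfin.
by rewrite fineK// ge0_fin_numE ?Lnorm_ge0.
Qed.

Lemma rho_lipschitz g : C1_plane g -> Linf_plane (d_rho g) ->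
  forall r r' a, `|g r a - g r' a|
    <= fine (Linf_norm_plane (d_rho g)) * `|r - r'|.
Proof.
move=> [_ dg _ cg _] Lg r r' a.
apply: (@lipschitz_of_derive1 _ (fun z => g z a)) => [x|x]; first exact: dg.
by apply: (Linf_plane_pointwise cg); rewrite -Linf_plane_norm_fin.
Qed.

(** The increment of g in its second argument is a function of the first argument
whose derivative is an increment of d_rho g, so it is controlled by the mixed
derivative. *)
Lemma mixed_lipschitz g : C1_plane g -> C1_plane (d_rho g) ->
  Linf_plane (d_A (d_rho g)) ->
  forall r r' a b, `|(g r a - g r b) - (g r' a - g r' b)|
    <= fine (Linf_norm_plane (d_A (d_rho g))) * `|r - r'| * `|a - b|.
Proof.
move=> [_ dg _ _ _] [_ _ ddg _ cg] Lg r r' a b.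
have da x : derivable (fun z => g z a) x 1 by exact: dg.
have db x : derivable (fun z => g z b) x 1 by exact: dg.
rewrite mulrAC.
apply: (@lipschitz_of_derive1 _ (fun z => g z a - g z b)) => x.
  exact: derivableB.
rewrite derive1E deriveB// -!derive1E.
apply: (@lipschitz_of_derive1 _ (fun z => d_rho g x z)) => y; first exact: ddg.
by apply: (Linf_plane_pointwise cg); rewrite -Linf_plane_norm_fin.
Qed.

Lemma A_lipschitz g M : C1_plane g ->
  (forall r a, `|d_A g r a| <= M * `|r|) ->
  forall r a b, `|g r a - g r b| <= M * `|r| * `|a - b|.
Proof.
move=> [_ _ dg _ _] gM r a b.
by apply: (@lipschitz_of_derive1 _ (g r)) => x; [exact: dg|exact: gM].
Qed.

Lemma A_second_difference g M : C2_plane g ->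
  (forall r a, `|d_A g r a| <= M * `|r|) ->
  (forall r a, `|d_A (d_A g) r a| <= M * `|r|) ->
  forall r a b a' b', `|(g r a - g r b) - (g r a' - g r b')| <=
    M * `|r| * (`|(a - b) - (a' - b')|
                + `|a' - b'| * (`|a - b| + `|a' - b'| + `|a - a'|)).
Proof.
move=> [[_ _ dg _ _] _ C1A] gM gMM r a b a' b'; rewrite mulrDr mulrA.
apply: (@second_difference (g r) (M * `|r|) (M * `|r|)) => [x|x|];
  [exact: dg|exact: gM|].
exact: (A_lipschitz C1A gMM r).
Qed.

(** Only differences of the kernel enter the analysis: the first one is O(dx) and
the second one O(dx^2), with a constant that does not depend on dx. *)
Lemma kernel_bounds mu : C2_line mu -> W2inf_line mu ->
  exists2 B, 0 <= B & forall dx, 0 < dx -> forall j : int,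
    `|mu_mesh mu dx (j + 1) - mu_mesh mu dx j| <= B * dx /\
    `|mu_mesh mu dx (j + 1) - 2 * mu_mesh mu dx j + mu_mesh mu dx (j - 1)|
      <= B * dx ^+ 2.
Proof.
move=> [d1 d2 c2] W.
have cont (h : R -> R) : (forall x, derivable h x 1) -> continuous h.
  by move=> dh x; apply/differentiable_continuous/derivable1_diffP.
have bounded k : (k <= 2)%N -> continuous (derive1n k mu) ->
    exists2 C, 0 <= C & forall x, `|derive1n k mu x| <= C.
  move=> k2 ck.
  exists (fine ('N[@lebesgue_measure R]_+oo[EFin \o derive1n k mu])%E).
    by rewrite fine_ge0// Lnorm_ge0.
  apply: Linf_line_pointwise => //.
  have := W k k2 => /sub_Lfun_finLfun/set_mem; rewrite /finite_norm /= => fin.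
  by rewrite fineK// ge0_fin_numE ?Lnorm_ge0.
have [C1 C10 b1] := bounded 1 isT (cont _ d2).
have [C2 C20 b2] := bounded 2 isT c2.
have lip2 := lipschitz_of_derive1 d2 b2.
(* 3 * dx is the sum of the two increments and of the shift between them. *)
exists (C1 + 3 * C2) => [|dx dx0 j]; first by lra.
have step1 (i : int) : mesh_point dx (i + 1) - mesh_point dx i = dx.
  by rewrite /mesh_point intrD; ring.
split.
  apply: le_trans (lipschitz_of_derive1 d1 b1 _ _) _.
  by rewrite step1 (gtr0_norm dx0) ler_wpM2r ?(ltW dx0)//; lra.
have s0 := step1 (j - 1); rewrite subrK in s0.
have := second_difference d1 b1 lip2 (mesh_point dx (j + 1)) (mesh_point dx j)
  (mesh_point dx j) (mesh_point dx (j - 1)).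
rewrite step1 s0 subrr normr0 mulr0 add0r (gtr0_norm dx0).
rewrite [X in `|X|](_ : _ = mu_mesh mu dx (j + 1) - 2 * mu_mesh mu dx j
    + mu_mesh mu dx (j - 1)); last by rewrite /mu_mesh; ring.
move=> /le_trans; apply.
have -> : C2 * dx * (dx + dx + dx) = 3 * C2 * dx ^+ 2 by ring.
by rewrite ler_wpM2r ?exprn_ge0 ?(ltW dx0)//; lra.
Qed.

Lemma kernel_support mu dx : compact_support mu -> 0 < dx ->
  exists N : nat, forall j : int, (N < `|j|)%N -> mu_mesh mu dx j = 0.
Proof.
move=> /compact_bounded[X [Xr Xb]] dx0.
pose Y := `|X| + 1.
have Yb : forall x, mu x != 0 -> `|x| <= Y.
  move=> x mx; apply: (Xb Y); last exact: subset_closure.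
  by rewrite /Y; have := ler_norm X; lra.
exists (Num.truncn (Y / dx)).+1 => j Nj.
apply/eqP/negPn/negP => /Yb; apply/negP; rewrite -ltNge.
rewrite /mesh_point normrM (gtr0_norm dx0) -ltr_pdivrMr//.
have : Y / dx < (Num.truncn (Y / dx)).+1%:R by exact: truncnS_gt.
move=> /lt_trans; apply.
by rewrite -intr_norm -(ltr_nat R) natr_absz in Nj *.
Qed.

End Regularity.

(** * One step of the scheme: positivity and mass *)

Section OneStep.
Variable R : realType.
Variables (f : R -> R -> R) (mu : R -> R) (theta alpha dx dt : R).
Variables (L K M B : R) (N : nat).

Let lambda : R := dt / dx.

Hypothesis theta_itv : 0 <= theta <= 2^-1.
Hypothesis dx_gt0 : 0 < dx.
Hypothesis dt_gt0 : 0 < dt.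
Hypothesis L_ge0 : 0 <= L.
Hypothesis K_ge0 : 0 <= K.
Hypothesis M_ge0 : 0 <= M.
Hypothesis B_ge0 : 0 <= B.
Hypothesis CFL_sum : lambda * L + alpha <= 8 / 27.
Hypothesis CFL_slope : lambda * L <= 2 / 27.
Hypothesis CFL_visc : lambda * L <= alpha.

Hypothesis f_0 : forall a, f 0 a = 0.
Hypothesis f_lip : forall r r' a, `|f r a - f r' a| <= L * `|r - r'|.
Hypothesis f_A_lip : forall r a b, `|f r a - f r b| <= M * `|r| * `|a - b|.
Hypothesis f_mixed : forall r r' a b,
  `|(f r a - f r b) - (f r' a - f r' b)| <= K * `|r - r'| * `|a - b|.
Hypothesis f_AA : forall r a b a' b',
  `|(f r a - f r b) - (f r a' - f r b')| <=
    M * `|r| * (`|(a - b) - (a' - b')|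
              + `|a' - b'| * (`|a - b| + `|a' - b'| + `|a - a'|)).

Hypothesis mu_diff1 : forall j : int,
  `|mu_mesh mu dx (j + 1) - mu_mesh mu dx j| <= B * dx.
Hypothesis mu_diff2 : forall j : int,
  `|mu_mesh mu dx (j + 1) - 2 * mu_mesh mu dx j + mu_mesh mu dx (j - 1)|
    <= B * dx ^+ 2.
Hypothesis mu_supp : forall j : int, (N < `|j|)%N -> mu_mesh mu dx j = 0.

Lemma lambda_gt0 : 0 < lambda. Proof. by rewrite divr_gt0. Qed.

Lemma lambda_dx : lambda * dx = dt.
Proof. by rewrite /lambda divfK// gt_eqF. Qed.

Lemma f_secant r r' a :
  exists2 c, `|lambda * c| <= lambda * L & f r a - f r' a = c * (r - r').
Proof.
have l0 := lambda_gt0.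
have [->|rr'] := eqVneq r r'.
  by exists 0; rewrite ?mulr0 ?normr0 ?subrr ?mulr0 // mulr_ge0// ltW.
have d0 : r - r' != 0 by rewrite subr_eq0.
exists ((f r a - f r' a) / (r - r')); last by rewrite divfK.
rewrite normrM (gtr0_norm l0) ler_pM2l// normrM normfV.
by rewrite ler_pdivrMr ?normr_gt0//; exact: f_lip.
Qed.

Lemma f_linear_growth r a : 0 <= r -> `|f r a| <= L * r.
Proof.
by move=> r0; have := f_lip r 0 a; rewrite f_0 !subr0 (ger0_norm r0).
Qed.

(** The numerical viscosity alpha dominates lambda * L, which makes the flux
nondecreasing in its first argument and nonincreasing in its second; the
incremental coefficients are (alpha +- lambda * f') / 2. *)
Lemma flux_harten r s r' s' a : exists p q,
  [/\ 0 <= p <= 4 / 27, 0 <= q <= 4 / 27 &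
    lambda * (numerical_flux f alpha dx dt r s a
              - numerical_flux f alpha dx dt r' s' a)
    = p * (r - r') - q * (s - s')].
Proof.
have l0 := lambda_gt0.
have [c cL fc] := f_secant r r' a.
have [d dL fd] := f_secant s s' a.
exists ((lambda * c + alpha) / 2), ((alpha - lambda * d) / 2).
move: cL dL; rewrite !ler_norml => /andP[c1 c2] /andP[d1 d2].
have hs := CFL_sum; have hv := CFL_visc.
split; [lra|lra|].
rewrite /numerical_flux -/lambda.
have -> : f r a = f r' a + c * (r - r') by rewrite -fc; ring.
have -> : f s a = f s' a + d * (s - s') by rewrite -fd; ring.
by field; rewrite gt_eqF.
Qed.

Lemma minmodC (a b c : R) : minmod a b c = minmod c b a.
Proof.
rewrite /minmod.
have -> : [&& 0 < a, 0 < b & 0 < c] = [&& 0 < c, 0 < b & 0 < a].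
  by case: (0 < a); case: (0 < b); case: (0 < c).
have -> : [&& a < 0, b < 0 & c < 0] = [&& c < 0, b < 0 & a < 0].
  by case: (a < 0); case: (b < 0); case: (c < 0).
by rewrite [Num.min b c]minC minCA [Num.min a b]minC [Num.max b c]maxC maxCA
  [Num.max a b]maxC.
Qed.

(** With [minmodC], the slope of a cell is a fraction in [0, 1] of the jump on each
of its two sides. *)
Lemma minmod_left (a b c : R) :
  exists2 t, 0 <= t <= 1 & minmod a b c = t * a.
Proof.
rewrite /minmod; case: ifP => [/and3P[a0 b0 c0]|_].
  exists (Num.min a (Num.min b c) / a); last by rewrite divfK// gt_eqF.
  rewrite ler_pdivrMr// mul1r ge_min lexx andbT divr_ge0 ?(ltW a0)//.
  by rewrite !le_min !ltW.
case: ifP => [/and3P[a0 b0 c0]|_].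
  exists (Num.max a (Num.max b c) / a); last by rewrite divfK// lt_eqF.
  rewrite ler_ndivrMr// mul1r le_max lexx andbT.
  by rewrite -mulrNN -invrN divr_ge0// oppr_ge0 ?ge_max ?ltW.
by exists 0; rewrite ?mul0r ?lexx ?ler01.
Qed.

(** For a state of mass m, [conv_const m] times dx, resp. dx^2, bounds the first,
resp. second, differences of the two discrete convolutions. Then [var_const m]
and [source_const m] are the factors in front of a jump of the state, resp. in
front of dx times its value, in the differences of nonlocal increments
of f. *)
Definition conv_const (m : R) : R := 2 * (B * m).
Definition var_const (m : R) : R := K * conv_const m.
Definition source_const (m : R) : R :=
  M * conv_const m * (1 + 4 * conv_const m).

Section FixedState.
Variables (rho : int -> R) (m : R).
Hypothesis rho_ge0 : forall j, 0 <= rho j.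
Hypothesis rho_mass : abs_sum_le rho (m / dx).

Local Notation q := (conv_const m).
Local Notation k1 := (var_const m).
Local Notation k2 := (source_const m).
Local Notation slp := (slope theta rho).
Local Notation rm := (rho_minus theta rho).
Local Notation rp := (rho_plus theta rho).
Local Notation u := (rho_mid_minus f mu theta dx dt rho).
Local Notation v := (rho_mid_plus f mu theta dx dt rho).
Local Notation A := (conv_mid f mu theta dx dt rho).
Local Notation c := (conv mu dx rho).
Local Notation cm := (conv_minus mu theta dx rho).
Local Notation cp := (conv_plus mu theta dx rho).
Local Notation F := (numerical_flux f alpha dx dt).
Local Notation fl := (flux_mid f mu theta alpha dx dt rho).

(** Since the neighbours are nonnegative, the limited slope cannot exceed the value
of the cell: the reconstructed face values stay nonnegative. *)
Lemma slope_left j :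
  exists2 t, 0 <= t <= 1 & slp j = t * (rho j - rho (j - 1)).
Proof.
have [t t01 e] := minmod_left (rho j - rho (j - 1))
  ((rho (j + 1) - rho (j - 1)) / 2) (rho (j + 1) - rho j).
exists (2 * theta * t); last by rewrite /slope e mulrA.
move/andP: theta_itv => [? ?]; move/andP: t01 => [? ?].
by apply/andP; split; nra.
Qed.

Lemma slope_right j :
  exists2 t, 0 <= t <= 1 & slp j = t * (rho (j + 1) - rho j).
Proof.
have [t t01 e] := minmod_left (rho (j + 1) - rho j)
  ((rho (j + 1) - rho (j - 1)) / 2) (rho j - rho (j - 1)).
exists (2 * theta * t); last by rewrite /slope minmodC e mulrA.
move/andP: theta_itv => [? ?]; move/andP: t01 => [? ?].
by apply/andP; split; nra.
Qed.

Lemma slope_le j : `|slp j| <= rho j.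
Proof.
have [t /andP[t0 t1] et] := slope_left j.
have [s /andP[s0 s1] es] := slope_right j.
have r0 := rho_ge0 j; have r1 := rho_ge0 (j + 1); have r2 := rho_ge0 (j - 1).
by rewrite ler_norml; apply/andP; split; [rewrite es|rewrite et]; nra.
Qed.

Lemma rho_minus_itv j : rho j / 2 <= rm j <= 3 / 2 * rho j.
Proof.
by have := slope_le j; rewrite ler_norml /rho_minus => /andP[? ?]; lra.
Qed.

Lemma rho_plus_itv j : rho j / 2 <= rp j <= 3 / 2 * rho j.
Proof.
by have := slope_le j; rewrite ler_norml /rho_plus => /andP[? ?]; lra.
Qed.

Lemma delta_le j : `|lambda * delta f mu theta dx rho j| <= 4 / 27 * rho j.
Proof.
have l0 := lambda_gt0; have r0 := rho_ge0 j.
have /andP[m1 m2] := rho_minus_itv j; have /andP[p1 p2] := rho_plus_itv j.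
have hm : `|f (rm j) (cm j)| <= L * rm j by apply: f_linear_growth; lra.
have hp : `|f (rp j) (cp j)| <= L * rp j by apply: f_linear_growth; lra.
rewrite normrM (gtr0_norm l0) /delta.
have sum2 : rm j + rp j = 2 * rho j by rewrite /rho_minus /rho_plus; lra.
apply: (@le_trans _ _ (lambda * (L * rm j + L * rp j))).
  by rewrite ler_pM2l//; apply: le_trans (ler_normB _ _) _; exact: lerD.
have hc := CFL_slope.
by rewrite -mulrDr sum2 mulrA; nra.
Qed.

Lemma mid_minus_itv j : 0 <= u j <= 2 * rho j.
Proof.
have r0 := rho_ge0 j; have /andP[m1 m2] := rho_minus_itv j.
have := delta_le j; rewrite ler_norml => /andP[d1 d2].
by rewrite /rho_mid_minus -/lambda; lra.
Qed.

Lemma mid_plus_itv j : 0 <= v j <= 2 * rho j.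
Proof.
have r0 := rho_ge0 j; have /andP[m1 m2] := rho_plus_itv j.
have := delta_le j; rewrite ler_norml => /andP[d1 d2].
by rewrite /rho_mid_plus -/lambda; lra.
Qed.

(** Comparison of the flux with the zero state, at which it vanishes: what goes
through the face splits into an outflow of the left cell and an inflow from the
right cell. *)
Lemma flux_in_out j : exists pq : R * R,
  [/\ 0 <= pq.1 <= 8 / 27 * rho j, 0 <= pq.2 <= 8 / 27 * rho (j + 1) &
     lambda * fl j = pq.1 - pq.2].
Proof.
have [p [q [/andP[p0 p1] /andP[q0 q1] e]]] :=
  flux_harten (u j) (v (j + 1)) 0 0 (A j).
have /andP[u0 u1] := mid_minus_itv j; have /andP[v0 v1] := mid_plus_itv (j + 1).
exists (p * u j, q * v (j + 1)); split => /=.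
- by apply/andP; split; nra.
- by apply/andP; split; nra.
- move: e; rewrite !subr0 => <-.
  by rewrite [F 0 0 _]/numerical_flux f_0 subrr !(mulr0, addr0, mul0r, subr0).
Qed.

Lemma step_positive_mass :
  (forall j, 0 <= step f mu theta alpha dx dt rho j) /\
  (forall C, abs_sum_le rho C ->
     abs_sum_le (step f mu theta alpha dx dt rho) C).
Proof.
have [pq pqP] := boolp.choice flux_in_out.
have stepE j : step f mu theta alpha dx dt rho j =
    (rho j - (pq j).1 - (pq (j - 1)).2) + (pq (j - 1)).1 + (pq j).2.
  rewrite /step -/lambda mulrBr.
  by have [_ _ ->] := pqP j; have [_ _ ->] := pqP (j - 1); ring.
have w_ge0 j : 0 <= rho j - (pq j).1 - (pq (j - 1)).2.
  have [/andP[_ a] _ _] := pqP j; have [_ /andP[_ b] _] := pqP (j - 1).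
  by move: b; rewrite subrK => b; have := rho_ge0 j; lra.
have out_ge0 j : 0 <= (pq j).1 by have [/andP[]] := pqP j.
have in_ge0 j : 0 <= (pq j).2 by have [_ /andP[]] := pqP j.
have step_ge0 j : 0 <= step f mu theta alpha dx dt rho j.
  by rewrite stepE; apply: addr_ge0 => //; apply: addr_ge0.
split=> // C rhoC.
apply: (@abs_sum_le_redistribute _ rho _
  (fun j => rho j - (pq j).1 - (pq (j - 1)).2)
  (fun j => (pq j).1) (fun j => (pq (j - 1)).2)) => //= j.
- by rewrite (ger0_norm (rho_ge0 j)); ring.
- by rewrite (ger0_norm (step_ge0 j)) stepE addrK.
Qed.

(** * The discrete convolutions *)

Let vanishes_off (D : seq int) (i : int) :=
  forall l, l \notin D -> mu_mesh mu dx (i - l) = 0.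

(** A single finite window of indices serves for the convolutions at all the cells
that enter a second difference. *)
Lemma kernel_window (j : int) : exists2 D : seq int, uniq D &
  [/\ vanishes_off D (j - 1), vanishes_off D j, vanishes_off D (j + 1)
    & vanishes_off D (j + 1 + 1)].
Proof.
exists (int_window j (N + 2)); first exact: int_window_uniq.
by split=> l lD; apply: mu_supp; rewrite ltnNge; apply: contraNN lD => il;
  apply: mem_int_window; move: il; clear; lia.
Qed.

Section Window.
Variables (D : seq int) (x : int -> R) (C : R).
Hypothesis D_uniq : uniq D.
Hypothesis x_le : abs_sum_le x C.

Local Notation S i := (\sum_(l <- D) mu_mesh mu dx (i - l) * x l).

Lemma kernel_diff1 i : `|S (i + 1) - S i| <= B * dx * C.
Proof.
rewrite -sumrB; under eq_bigr do rewrite -mulrBl [i + 1 - _]addrAC.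
apply: norm_sum_kernel_le => //.
by rewrite mulr_ge0// ltW.
Qed.

Lemma kernel_diff2 i : `|S (i + 1) - 2 * S i + S (i - 1)| <= B * dx ^+ 2 * C.
Proof.
rewrite mulr_sumr -sumrB -big_split/=.
under eq_bigr do
  rewrite mulrA -mulrBl -mulrDl [i + 1 - _]addrAC [i - 1 - _]addrAC.
apply: norm_sum_kernel_le => //.
by rewrite mulr_ge0// exprn_ge0// ltW.
Qed.
End Window.

Lemma conv_diff1 (j : int) : `|c (j + 1) - c j| <= B * m * dx.
Proof.
have [D uD [D1 D2 D3 D4]] := kernel_window j.
rewrite /conv !(fsum_window _ uD) //.
rewrite -mulrBr normrM (gtr0_norm dx_gt0).
have -> : B * m * dx = dx * (B * dx * (m / dx)) by field; rewrite gt_eqF.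
by rewrite ler_pM2l// kernel_diff1.
Qed.

Lemma conv_diff2 (j : int) :
  `|c (j + 1) - 2 * c j + c (j - 1)| <= B * m * dx ^+ 2.
Proof.
have [D uD [D1 D2 D3 D4]] := kernel_window j.
rewrite /conv !(fsum_window _ uD) //.
rewrite mulrCA -mulrBr -mulrDr normrM (gtr0_norm dx_gt0).
have -> : B * m * dx ^+ 2 = dx * (B * dx ^+ 2 * (m / dx)).
  by field; rewrite gt_eqF.
by rewrite ler_pM2l// kernel_diff2.
Qed.

Lemma mid_mass : abs_sum_le u (2 * (m / dx)) /\ abs_sum_le v (2 * (m / dx)).
Proof.
by split; apply: abs_sum_le_dom (abs_sum_leZ _ rho_mass) => // j;
  rewrite !ger0_norm ?mulr_ge0//;
  have /andP[? ?] := mid_minus_itv j; have /andP[? ?] := mid_plus_itv j.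
Qed.

Lemma conv_midE (i : int) D : uniq D ->
  vanishes_off D i -> vanishes_off D (i + 1) ->
  A i = dx / 2 * (\sum_(l <- D) mu_mesh mu dx (i + 1 - l) * v l
                  + \sum_(l <- D) mu_mesh mu dx (i - l) * u l).
Proof.
move=> uD Di Di1; rewrite /conv_mid (fsbigE D)//; last first.
  by move=> l _ lD; rewrite Di// Di1// !mul0r addr0.
rewrite -big_split big_mkcond/=; congr (_ * _).
by apply: eq_bigr => l _; rewrite in_setT.
Qed.

Lemma conv_mid_diff1 (j : int) : `|A (j + 1) - A j| <= q * dx.
Proof.
have [D uD [D1 D2 D3 D4]] := kernel_window j; have [mu_ mv_] := mid_mass.
rewrite !(conv_midE uD)//.
have -> : q * dx = dx / 2 * (B * dx * (2 * (m / dx)) + B * dx * (2 * (m / dx))).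
  by rewrite /conv_const; field; rewrite gt_eqF.
have := kernel_diff1 uD mv_ (j + 1); have := kernel_diff1 uD mu_ j.
set a1 := \sum_(l <- D) _; set a2 := \sum_(l <- D) _.
set b1 := \sum_(l <- D) _; set b2 := \sum_(l <- D) _ => h1 h2.
rewrite [X in `|X|](_ : _ = dx / 2 * ((b1 - b2) + (a1 - a2))); last by ring.
rewrite normrM gtr0_norm ?divr_gt0// ler_pM2l ?divr_gt0//.
by apply: le_trans (ler_normD _ _) _; exact: lerD.
Qed.

Lemma conv_mid_diff2 (j : int) :
  `|A (j + 1) - 2 * A j + A (j - 1)| <= q * dx ^+ 2.
Proof.
have [D uD [D1 D2 D3 D4]] := kernel_window j; have [mu_ mv_] := mid_mass.
rewrite !(conv_midE uD) ?subrK//.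
have -> : q * dx ^+ 2
    = dx / 2 * (B * dx ^+ 2 * (2 * (m / dx)) + B * dx ^+ 2 * (2 * (m / dx))).
  by rewrite /conv_const; field; rewrite gt_eqF.
have := kernel_diff2 uD mv_ (j + 1); have := kernel_diff2 uD mu_ j.
rewrite addrK.
set a1 := \sum_(l <- D) _; set a2 := \sum_(l <- D) _; set a3 := \sum_(l <- D) _.
set b1 := \sum_(l <- D) _; set b2 := \sum_(l <- D) _; set b3 := \sum_(l <- D) _.
move=> h1 h2.
rewrite [X in `|X|](_ : _ =
   dx / 2 * ((b1 - 2 * b2 + b3) + (a1 - 2 * a2 + a3))); last by ring.
rewrite normrM gtr0_norm ?divr_gt0// ler_pM2l ?divr_gt0//.
by apply: le_trans (ler_normD _ _) _; exact: lerD.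
Qed.

(** * Growth of the total variation in one step *)

Let jump (j : int) : R := rho (j + 1) - rho j.
(** The local size, up to dx or dt, of all the error terms. It is summable: the
jumps sum to the variation and dx * rho to the mass. *)
Let osc (j : int) : R := k1 * `|jump j| + k2 * dx * rho j.

Lemma mass_ge0 : 0 <= m.
Proof. by have := abs_sum_le_ge0 rho_mass; rewrite pmulr_lge0// invr_gt0. Qed.

Lemma conv_const_ge0 : 0 <= q.
Proof. by rewrite /conv_const !mulr_ge0// mass_ge0. Qed.

Lemma var_const_ge0 : 0 <= k1.
Proof. by rewrite /var_const mulr_ge0// conv_const_ge0. Qed.

Lemma source_const_ge0 : 0 <= k2.
Proof.
have q0 := conv_const_ge0; have q1 : 0 <= 1 + 4 * q by lra.
by rewrite /source_const mulr_ge0// mulr_ge0.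
Qed.

Lemma osc_ge0 j : 0 <= osc j.
Proof.
have h1 := var_const_ge0; have h2 := source_const_ge0; have dx0 := ltW dx_gt0.
apply: addr_ge0; first exact: mulr_ge0.
by apply: mulr_ge0 => //; exact: mulr_ge0.
Qed.

Lemma osc_sum V : abs_sum_le jump V -> abs_sum_le osc (k1 * V + k2 * m).
Proof.
move=> DV; have h1 := var_const_ge0; have h2 := source_const_ge0.
have dx0 := ltW dx_gt0.
apply: abs_sum_leD; first by apply: abs_sum_leZ => //; exact: abs_sum_le_abs.
have -> : k2 * m = k2 * dx * (m / dx) by field; rewrite gt_eqF.
by apply: abs_sum_leZ => //; exact: mulr_ge0.
Qed.

(** Passing through the increment of f at [r'] between [a] and [b] separates the
change of the first argument, paid by the mixed derivative, from the change of
the second one, paid by the derivatives in A, which carry the factor |r'|. *)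
Lemma f_increment r r' a b a' b' :
  `|a - b| <= q * dx -> `|a' - b'| <= q * dx ->
  `|(a - b) - (a' - b')| <= q * dx ^+ 2 ->
  `|a - a'| <= 2 * q * dx ->
  `|(f r a - f r b) - (f r' a' - f r' b')|
    <= dx * (k1 * `|r - r'| + k2 * dx * `|r'|).
Proof.
move=> ab ab' abab aa.
have q0 := conv_const_ge0; have dx0 := ltW dx_gt0.
have -> : (f r a - f r b) - (f r' a' - f r' b') =
   ((f r a - f r b) - (f r' a - f r' b)) +
   ((f r' a - f r' b) - (f r' a' - f r' b')) by ring.
apply: le_trans (ler_normD _ _) _; rewrite mulrDr; apply: lerD.
  apply: le_trans (f_mixed r r' a b) _.
  apply: (@le_trans _ _ (K * `|r - r'| * (q * dx))).
    by rewrite ler_wpM2l// mulr_ge0.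
  by rewrite /var_const le_eqVlt; apply/orP; left; apply/eqP; ring.
apply: le_trans (f_AA r' a b a' b') _.
apply: (@le_trans _ _ (M * `|r'| *
   (q * dx ^+ 2 + q * dx * (q * dx + q * dx + 2 * q * dx)))).
  rewrite ler_wpM2l ?mulr_ge0// lerD// ler_pM// ?addr_ge0//.
  by apply: lerD => //; exact: lerD.
by rewrite /source_const le_eqVlt; apply/orP; left; apply/eqP; ring.
Qed.

Lemma conv_slope_le j : `|cm j - cp j| <= B * m * dx.
Proof.
have := conv_diff1 j; have := conv_diff1 (j - 1); rewrite subrK.
have -> : cm j - cp j = theta * ((c (j + 1) - c j) + (c j - c (j - 1))).
  by rewrite /conv_minus /conv_plus /conv_slope; field.
move/andP: theta_itv => [t0 t1].
rewrite !ler_norml => /andP[a1 a2] /andP[b1 b2].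
by apply/andP; split; nra.
Qed.

(** The difference of two consecutive convolution slopes is a sum of two second
differences of the convolution, hence O(dx^2). *)
Lemma conv_slope_diff j :
  `|(cm (j + 1) - cp (j + 1)) - (cm j - cp j)| <= B * m * dx ^+ 2.
Proof.
have := conv_diff2 j; have := conv_diff2 (j + 1); rewrite addrK.
have -> : (cm (j + 1) - cp (j + 1)) - (cm j - cp j) = theta *
    ((c (j + 1 + 1) - 2 * c (j + 1) + c j) + (c (j + 1) - 2 * c j + c (j - 1))).
  by rewrite /conv_minus /conv_plus /conv_slope addrK; field.
move/andP: theta_itv => [t0 t1].
rewrite !ler_norml => /andP[a1 a2] /andP[b1 b2].
by apply/andP; split; nra.
Qed.

Lemma conv_face_diff j :
  `|cm (j + 1) - cm j| <= q * dx.
Proof.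
have := conv_diff1 j; have := conv_slope_le j; have := conv_slope_le (j + 1).
have em i : cm i = c i + (cm i - cp i) / 2.
  by rewrite /conv_minus /conv_plus; field.
rewrite !ler_norml => /andP[a1 a2] /andP[b1 b2] /andP[c1 c2].
by have := em j; have := em (j + 1); rewrite /conv_const => *;
  apply/andP; split; lra.
Qed.

Lemma slope_pair j : exists t s, [/\ 0 <= t <= 1, 0 <= s <= 1,
  slp (j + 1) = t * jump j & slp j = s * jump j].
Proof.
have [t t01 et] := slope_left (j + 1); have [s s01 es] := slope_right j.
by exists t, s; split=> //; rewrite et addrK.
Qed.

(** The part of [delta] due to the jump of the convolution inside a cell; the other
part is proportional to the slope. *)
Let delta_A (j : int) : R := f (rp j) (cm j) - f (rp j) (cp j).

Lemma delta_A_diff j : `|delta_A (j + 1) - delta_A j| <= 2 * dx * osc j.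
Proof.
have q0 := conv_const_ge0; have dx0 := ltW dx_gt0.
have Bm : 0 <= B * m by rewrite mulr_ge0// mass_ge0.
have fm := conv_face_diff j.
apply: le_trans (@f_increment _ _ _ _ _ _ _ _ _ _) _.
- by apply: le_trans (conv_slope_le _) _; rewrite ler_wpM2r// /conv_const; lra.
- by apply: le_trans (conv_slope_le _) _; rewrite ler_wpM2r// /conv_const; lra.
- apply: le_trans (conv_slope_diff _) _.
  by rewrite ler_wpM2r ?exprn_ge0// /conv_const; lra.
- by apply: le_trans fm _; rewrite ler_wpM2r//; lra.
have h1 := var_const_ge0; have h2 := source_const_ge0.
have [t [s [/andP[t0 t1] /andP[s0 s1] et es]]] := slope_pair j.
have /andP[p0 p1] := rho_plus_itv j; have r0 := rho_ge0 j.
have -> : 2 * dx * osc j = dx * (k1 * (2 * `|jump j|) + k2 * dx * (2 * rho j)).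
  by rewrite /osc; ring.
rewrite ler_wpM2l//; apply: lerD; last first.
  by apply: ler_wpM2l; [exact: mulr_ge0|rewrite ger0_norm; lra].
apply: ler_wpM2l => //.
have -> : rp (j + 1) - rp j = (1 - t / 2 + s / 2) * jump j.
  by rewrite /rho_plus et es /jump; field.
rewrite normrM ler_wpM2r// ler_norml; apply/andP; split; lra.
Qed.

(** The two limited slopes next to a face change the jump by at most half of it
each, in opposite directions, and the time evolution by at most lambda * L of
it; so the jumps of both mid-time values are nonnegative multiples of the jump
of the state. The error [E] is common to both. *)
Lemma mid_diff j : exists E a b,
  [/\ `|E| <= dt * osc j, 0 <= a <= 2, 0 <= b <= 2,
      u (j + 1) - u j = a * jump j + E & v (j + 1) - v j = b * jump j + E].
Proof.
have l0 := lambda_gt0; have dx0 := ltW dx_gt0.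
have [t [s [/andP[t0 t1] /andP[s0 s1] et es]]] := slope_pair j.
have deltaE i : exists2 z, `|z| <= 2 / 27 &
    lambda * delta f mu theta dx rho i = z * slp i + lambda * delta_A i.
  have [z zL fz] := f_secant (rm i) (rp i) (cm i).
  exists (lambda * z); first exact: le_trans zL CFL_slope.
  have -> : slp i = rm i - rp i by rewrite /rho_minus /rho_plus; field.
  by rewrite -[lambda * z * _]mulrA -fz /delta /delta_A; ring.
have [y yL ey] := deltaE (j + 1); have [z zL ez] := deltaE j.
exists (- (lambda / 2) * (delta_A (j + 1) - delta_A j)).
exists (1 + (t - s) / 2 - (y * t - z * s) / 2).
exists (1 - (t - s) / 2 - (y * t - z * s) / 2).
move: yL zL; rewrite !ler_norml => /andP[y1 y2] /andP[z1 z2].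
have yt : - (2 / 27) <= y * t <= 2 / 27 by apply/andP; split; nra.
have zs : - (2 / 27) <= z * s <= 2 / 27 by apply/andP; split; nra.
move/andP: yt => [? ?]; move/andP: zs => [? ?].
split.
- rewrite -ler_norml normrM normrN [`|lambda / 2|]gtr0_norm ?divr_gt0//.
  have -> : dt * osc j = lambda / 2 * (2 * dx * osc j).
    by rewrite -lambda_dx; field.
 by rewrite ler_pM2l ?divr_gt0// delta_A_diff.
- by lra.
- by lra.
- rewrite /rho_mid_minus -/lambda ![lambda / 2 * _]mulrAC ey ez.
  by rewrite /rho_minus et es /jump; field.
- rewrite /rho_mid_plus -/lambda ![lambda / 2 * _]mulrAC ey ez.
  by rewrite /rho_plus et es /jump; field.
Qed.

Lemma mid_diff_le j : `|u (j + 1) - u j| <= 2 * `|jump j| + dt * osc j /\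
  `|v (j + 1) - v j| <= 2 * `|jump j| + dt * osc j.
Proof.
have [E [a [b [EW /andP[a0 a2] /andP[b0 b2] -> ->]]]] := mid_diff j.
by split; apply: le_trans (ler_normD _ _) _; apply: lerD => //;
  rewrite normrM ler_wpM2r// ger0_norm.
Qed.

(** The change of the flux due to the change of the convolution from one face to
the next, at fixed states. *)
Let flux_A (j : int) : R :=
  F (u j) (v (j + 1)) (A (j + 1)) - F (u j) (v (j + 1)) (A j).

Lemma flux_A_diff j : `|lambda * (flux_A (j + 1) - flux_A j)| <=
  dt * ((1 + k1 * dt / 2) * (osc j + osc (j + 1))).
Proof.
have q0 := conv_const_ge0; have dx0 := ltW dx_gt0; have l0 := lambda_gt0.
have h1 := var_const_ge0; have h2 := source_const_ge0.
pose H (w : int -> R) (i : int) :=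
  (f (w (i + 1)) (A (j + 1 + 1)) - f (w (i + 1)) (A (j + 1)))
  - (f (w i) (A (j + 1)) - f (w i) (A j)).
have -> : flux_A (j + 1) - flux_A j = (H u j + H v (j + 1)) / 2.
  by rewrite /flux_A /H /numerical_flux -/lambda; field; rewrite gt_eqF.
have A1 := conv_mid_diff1 j; have A2 := conv_mid_diff1 (j + 1).
have AA : `|A (j + 1 + 1) - A (j + 1) - (A (j + 1) - A j)| <= q * dx ^+ 2.
  have := conv_mid_diff2 (j + 1); rewrite addrK.
  apply: le_trans; rewrite le_eqVlt; apply/orP; left; apply/eqP.
  by congr (`|_|); ring.
have qq : q * dx <= 2 * q * dx by rewrite ler_wpM2r//; lra.
have HW (w : int -> R) i : 0 <= w i <= 2 * rho i ->
    `|w (i + 1) - w i| <= 2 * `|jump i| + dt * osc i ->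
    `|H w i| <= dx * (2 * osc i + k1 * (dt * osc i)).
  move=> /andP[w0 w2] wd.
  apply: le_trans (f_increment (w (i + 1)) (w i) A2 A1 AA (le_trans A2 qq)) _.
  rewrite ler_wpM2l// (ger0_norm w0).
  have -> : 2 * osc i + k1 * (dt * osc i) =
     k1 * (2 * `|jump i| + dt * osc i) + k2 * dx * (2 * rho i).
    by rewrite /osc; ring.
  by apply: lerD; apply: ler_wpM2l => //; exact: mulr_ge0.
have Hu := HW u j (mid_minus_itv j) (mid_diff_le j).1.
have Hv := HW v (j + 1) (mid_plus_itv (j + 1)) (mid_diff_le (j + 1)).2.
rewrite normrM (gtr0_norm l0) normrM normfV [`|2|]ger0_norm//.
have -> : dt * ((1 + k1 * dt / 2) * (osc j + osc (j + 1))) = lambda *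
   ((dx * (2 * osc j + k1 * (dt * osc j))
     + dx * (2 * osc (j + 1) + k1 * (dt * osc (j + 1)))) / 2).
  by rewrite -[in LHS]lambda_dx -[in RHS]lambda_dx; field.
rewrite ler_pM2l// ler_pM2r// ?invr_gt0//.
by apply: le_trans (ler_normD _ _) _; exact: lerD.
Qed.

(** Harten's incremental form of the flux difference: the left jump enters through
the first argument of the flux and the right jump through the second, both with
coefficients in [0, 8/27], so that their sum is at most 1. *)
Lemma flux_diff j : exists pq : R * R,
  [/\ 0 <= pq.1 <= 8 / 27, 0 <= pq.2 <= 8 / 27 &
    `|lambda * (fl (j + 1) - fl j)
      - (pq.1 * jump j - pq.2 * jump (j + 1) + lambda * flux_A j)|
    <= dt * (osc j + osc (j + 1))].
Proof.
have [E [a [b [EW /andP[a0 a2] /andP[b0 b2] ua vb]]]] := mid_diff j.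
have [E' [a' [b' [EW' /andP[a0' a2'] /andP[b0' b2'] ua' vb']]]] :=
  mid_diff (j + 1).
have [y [z [/andP[y0 y1] /andP[z0 z1] yz]]] :=
  flux_harten (u (j + 1)) (v (j + 1 + 1)) (u j) (v (j + 1)) (A (j + 1)).
exists (y * a, z * b'); split => /=;
  [by apply/andP; split; nra|by apply/andP; split; nra|].
have -> : fl (j + 1) - fl j =
  F (u (j + 1)) (v (j + 1 + 1)) (A (j + 1)) - F (u j) (v (j + 1)) (A (j + 1))
  + flux_A j.
  by rewrite /flux_mid /flux_A; ring.
rewrite mulrDr yz ua vb'.
rewrite [X in `|X|](_ : _ = y * E - z * E'); last by ring.
apply: le_trans (ler_normB _ _) _; rewrite mulrDr; apply: lerD; rewrite normrM.
  by rewrite (ger0_norm y0) -[leRHS]mul1r; apply: ler_pM => //; lra.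
by rewrite (ger0_norm z0) -[leRHS]mul1r; apply: ler_pM => //; lra.
Qed.

Let next := step f mu theta alpha dx dt rho.

(** The jump of the new state is, up to errors of size dt * [osc] at three cells, a
redistribution of the old jumps, whose absolute sum does not increase. *)
Lemma step_variation V T : dt <= T -> abs_sum_le jump V ->
  abs_sum_le (fun j => next (j + 1) - next j)
    (V + dt * (3 * (3 + k1 * T) * (k1 * V + k2 * m))).
Proof.
move=> dtT DV.
have h1 := var_const_ge0; have l0 := lambda_gt0; have dt0 := ltW dt_gt0.
have T0 : 0 <= T by exact: le_trans dtT.
have [pq pqP] := boolp.choice flux_diff.
pose w0 (j : int) := (1 - (pq j).1 - (pq (j - 1)).2) * `|jump j|.
pose w1 (j : int) := (pq j).1 * `|jump j|.
pose w2 (j : int) := (pq (j - 1)).2 * `|jump j|.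
have w_ge0 j : [/\ 0 <= w0 j, 0 <= w1 j & 0 <= w2 j].
  have [/andP[? ?] _ _] := pqP j; have [_ /andP[? ?] _] := pqP (j - 1).
  by split; apply: mulr_ge0 => //; lra.
have wV : abs_sum_le (fun j => w0 j + w1 (j - 1) + w2 (j + 1)) V.
  apply: (@abs_sum_le_redistribute _ jump _ w0 w1 w2) => // j.
    by rewrite /w0 /w1 /w2; ring.
  have [? _ _] := w_ge0 j; have [_ ? _] := w_ge0 (j - 1).
  have [_ _ ?] := w_ge0 (j + 1).
  by rewrite ger0_norm// !addr_ge0.
have cT : 0 <= 3 + k1 * T by rewrite addr_ge0// mulr_ge0.
have WV := osc_sum DV.
have errV : abs_sum_le
    (fun j => dt * (3 + k1 * T) * (osc (j - 1) + osc j + osc (j + 1)))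
    (dt * (3 + k1 * T)
     * ((k1 * V + k2 * m) + (k1 * V + k2 * m) + (k1 * V + k2 * m))).
  apply: abs_sum_leZ; first exact: mulr_ge0.
  apply: abs_sum_leD; last exact: abs_sum_le_shift.
  by apply: abs_sum_leD => //; exact: abs_sum_le_shift.
have -> : V + dt * (3 * (3 + k1 * T) * (k1 * V + k2 * m)) = V +
  dt * (3 + k1 * T)
  * ((k1 * V + k2 * m) + (k1 * V + k2 * m) + (k1 * V + k2 * m)) by ring.
apply: abs_sum_le_dom (abs_sum_leD wV errV) => j /=.
have [w0j _ _] := w_ge0 j; have [_ w1j _] := w_ge0 (j - 1).
have [_ _ w2j] := w_ge0 (j + 1).
have W0 := osc_ge0 (j - 1); have W1 := osc_ge0 j; have W2 := osc_ge0 (j + 1).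
rewrite [leRHS]ger0_norm; last first.
  apply: addr_ge0; first by apply: addr_ge0 => //; exact: addr_ge0.
  apply: mulr_ge0; first exact: mulr_ge0.
  by apply: addr_ge0 => //; exact: addr_ge0.
have [/andP[p0 p1] /andP[q0 q1] e1] := pqP j.
have [/andP[p0' p1'] /andP[q0' q1'] e2] := pqP (j - 1).
have g := flux_A_diff (j - 1); rewrite !subrK in e2 g.
have -> : next (j + 1) - next j = jump j - lambda * (fl (j + 1) - fl j)
    + lambda * (fl j - fl (j - 1)).
  by rewrite /next /step -/lambda addrK /jump; ring.
set x := lambda * (fl (j + 1) - fl j) in e1 *.
set y := lambda * (fl j - fl (j - 1)) in e2 *.
set gg := lambda * (flux_A j - flux_A (j - 1)) in g *.
have gE : gg = lambda * flux_A j - lambda * flux_A (j - 1).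
  by rewrite /gg mulrBr.
set x' := x - _ in e1; set y' := y - _ in e2.
have -> : jump j - x + y = (1 - (pq j).1 - (pq (j - 1)).2) * jump j
   + (pq (j - 1)).1 * jump (j - 1) + (pq j).2 * jump (j + 1) + (- gg - x' + y').
  by rewrite gE /x' /y'; ring.
apply: le_trans (ler_normD _ _) _; apply: lerD.
  apply: le_trans (ler_normD _ _) _; apply: lerD.
    apply: le_trans (ler_normD _ _) _; apply: lerD; rewrite normrM ger0_norm//.
    by lra.
  by rewrite normrM ger0_norm// /w2 addrK.
have k1t : k1 * dt / 2 <= k1 * T.
  have := ler_wpM2l h1 dtT; have := mulr_ge0 h1 T0.
  by lra.
apply: le_trans (ler_normD _ _) _.
apply: le_trans (lerD (ler_normB _ _) (lexx _)) _; rewrite normrN.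
apply: le_trans (lerD (lerD g e1) e2) _.
rewrite -[leRHS]mulrA -!mulrDr ler_wpM2l//.
have := ler_wpM2r W0 k1t; have := ler_wpM2r W1 k1t.
have := mulr_ge0 (mulr_ge0 h1 T0) W2.
by lra.
Qed.

(** The displacement is lambda times the flux difference, so it is controlled by
the variation and by the O(dx) change of the convolution, which [f_A_lip] weighs
with the state itself. *)
Lemma step_displacement V T : dt <= T -> abs_sum_le jump V ->
  abs_sum_le (fun j => next j - rho j)
    (2 * V + T * (2 * (k1 * V + k2 * m)) + lambda * (2 * M * q * m)).
Proof.
move=> dtT DV.
have q0 := conv_const_ge0; have dx0 := ltW dx_gt0.
have l0 := lambda_gt0; have dt0 := ltW dt_gt0.
have T0 : 0 <= T by exact: le_trans dtT.
have WV := osc_sum DV.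
have W2 := abs_sum_leD (abs_sum_le_shift (-1) WV) WV.
have D1 := abs_sum_le_abs DV.
have D2 := abs_sum_leD (abs_sum_le_shift (-1) D1) D1.
have r2 := abs_sum_leD (abs_sum_le_shift (-1) rho_mass) rho_mass.
have l1 : 0 <= lambda * (M * q * dx).
  by apply: mulr_ge0; [exact: ltW|apply: mulr_ge0 => //; exact: mulr_ge0].
have -> : 2 * V + T * (2 * (k1 * V + k2 * m)) + lambda * (2 * M * q * m) =
  (V + V) + T * ((k1 * V + k2 * m) + (k1 * V + k2 * m))
  + lambda * (M * q * dx) * (m / dx + m / dx).
  by field; rewrite gt_eqF.
apply: abs_sum_le_dom (abs_sum_leD (abs_sum_leD D2 (abs_sum_leZ T0 W2))
  (abs_sum_leZ l1 r2)) => j /=.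
have W0 := osc_ge0 (j - 1); have W1 := osc_ge0 j.
have r0 := rho_ge0 (j - 1); have r1 := rho_ge0 j.
rewrite [leRHS]ger0_norm; last first.
  apply: addr_ge0; last by apply: mulr_ge0 => //; exact: addr_ge0.
  apply: addr_ge0; first exact: addr_ge0.
  by apply: mulr_ge0 => //; exact: addr_ge0.
have -> : next j - rho j = - (lambda * (fl j - fl (j - 1))).
  by rewrite /next /step -/lambda; ring.
have [pq [/andP[p0 p1] /andP[z0 z1] e1]] := flux_diff (j - 1).
rewrite !subrK in e1; rewrite normrN.
set y := lambda * _ in e1 *.
set y' := y - _ in e1.
have -> : y = (pq.1 * jump (j - 1) - pq.2 * jump j) + y'
    + lambda * flux_A (j - 1).
  by rewrite /y'; ring.
have GM : `|flux_A (j - 1)| <= M * q * dx * (rho (j - 1) + rho j).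
  have /andP[u0 u1] := mid_minus_itv (j - 1).
  have /andP[v0 v1] := mid_plus_itv j.
  have Aq := conv_mid_diff1 (j - 1); rewrite subrK in Aq.
  have bnd r s : 0 <= r -> r <= 2 * s ->
      `|f r (A j) - f r (A (j - 1))| <= M * (2 * s) * (q * dx).
    move=> rr rs; apply: le_trans (f_A_lip _ _ _) _.
    rewrite ler_pM ?mulr_ge0//; apply: ler_wpM2l => //.
    by rewrite ger0_norm.
  rewrite /flux_A subrK /numerical_flux -/lambda.
  rewrite [X in `|X|](_ : _ = ((f (u (j - 1)) (A j) - f (u (j - 1)) (A (j - 1)))
    + (f (v j) (A j) - f (v j) (A (j - 1)))) / 2); last first.
    by field; rewrite gt_eqF.
  rewrite normrM normfV [`|2|]ger0_norm// ler_pdivrMr//.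
  apply: le_trans (ler_normD _ _) _.
  apply: le_trans (lerD (bnd _ _ u0 u1) (bnd _ _ v0 v1)) _.
  by rewrite le_eqVlt; apply/orP; left; apply/eqP; ring.
apply: le_trans (ler_normD _ _) _; apply: lerD; last first.
  by rewrite normrM (gtr0_norm l0) -[leRHS]mulrA ler_pM2l.
apply: le_trans (ler_normD _ _) _; apply: lerD.
  apply: le_trans (ler_normB _ _) _; apply: lerD; rewrite normrM ger0_norm//.
    by rewrite -[leRHS]mul1r ler_wpM2r//; lra.
  by rewrite -[leRHS]mul1r ler_wpM2r//; lra.
by apply: le_trans e1 _; rewrite ler_wpM2r// addr_ge0.
Qed.

End FixedState.

(** * Iteration in time *)

Definition growth_const (m T : R) : R :=
  3 * (3 + var_const m * T) * (var_const m + source_const m).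

Definition variation_bound (m V0 T t : R) : R :=
  expR (growth_const m T * t) * (V0 + m).

Definition displacement_const (l m V0 T : R) : R :=
  let V := variation_bound m V0 T T in
  2 * V + T * (2 * (var_const m * V + source_const m * m))
  + l * (2 * M * conv_const m * m).

Section Iteration.
Variables (r0 : int -> R) (m V0 T : R).
Hypothesis r0_ge0 : forall j, 0 <= r0 j.
Hypothesis r0_mass : abs_sum_le r0 (m / dx).
Hypothesis r0_var : abs_sum_le (fun j => r0 (j + 1) - r0 j) V0.
Hypothesis dt_le_T : dt <= T.

Local Notation r := (fun n => iter n (step f mu theta alpha dx dt) r0).

Lemma iter_positive_mass n :
  (forall j, 0 <= r n j) /\ abs_sum_le (r n) (m / dx).
Proof.
elim: n => [//|n [rn_ge0 rn_mass]] /=.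
by have [ge0 mass] := step_positive_mass rn_ge0; split=> //; exact: mass.
Qed.

Lemma growth_const_ge0 : 0 <= growth_const m T.
Proof.
have h1 := var_const_ge0 r0_mass; have h2 := source_const_ge0 r0_mass.
have T0 : 0 <= T by rewrite (le_trans (ltW dt_gt0)).
apply: mulr_ge0; last exact: addr_ge0.
by apply: mulr_ge0 => //; apply: addr_ge0 => //; exact: mulr_ge0.
Qed.

(** Discrete Gronwall argument for V + m: the inhomogeneous bound
V + dt * (c1 * V + c2 * m) of one step is at most exp (c * dt) * (V + m) - m. *)
Lemma iter_variation n : abs_sum_le (fun j => r n (j + 1) - r n j)
  (variation_bound m V0 T (n%:R * dt) - m).
Proof.
elim: n => [|n IHn].
  by rewrite /variation_bound mul0r mulr0 expR0 mul1r addrK.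
have [rn_ge0 rn_mass] := iter_positive_mass n.
have := step_variation rn_ge0 rn_mass dt_le_T IHn.
apply: abs_sum_le_weaken.
have h1 := var_const_ge0 r0_mass; have h2 := source_const_ge0 r0_mass.
have m0 := mass_ge0 r0_mass; have c0 := growth_const_ge0.
have T0 : 0 <= T by rewrite (le_trans (ltW dt_gt0)).
have X0 := abs_sum_le_ge0 IHn.
set X := variation_bound m V0 T (n%:R * dt) in X0 *.
have XS : (1 + growth_const m T * dt) * X <=
    variation_bound m V0 T (n.+1%:R * dt).
  rewrite /X /variation_bound -natr1 [(_ + 1) * dt]mulrDl mul1r.
  rewrite [growth_const m T * (_ + _)]mulrDr expRD.
  rewrite [expR _ * expR _]mulrC -[leRHS]mulrA ler_wpM2r ?expR_ge1Dx//.
  by move: X0; rewrite subr_ge0; exact: le_trans.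
suff : dt * (3 * (3 + var_const m * T)
     * (var_const m * (X - m) + source_const m * m))
    <= growth_const m T * dt * X.
  by move: XS; rewrite mulrDl mul1r; lra.
rewrite [growth_const m T * dt]mulrC -[leRHS]mulrA ler_pM2l// /growth_const.
rewrite -[leRHS]mulrA.
apply: ler_wpM2l; first by rewrite mulr_ge0// addr_ge0// mulr_ge0.
have Xm : m <= X by rewrite -subr_ge0.
by have := mulr_ge0 h1 m0; have := ler_wpM2l h2 Xm; lra.
Qed.

Lemma iter_time_lipschitz n k : (n + k)%N%:R * dt <= T ->
  abs_sum_le (fun j => r (n + k)%N j - r n j)
    (k%:R * displacement_const (dt / dx) m V0 T).
Proof.
elim: k => [_|k IHk nkT].
  move=> s us; rewrite mul0r addn0.
  by rewrite big1// => j _; rewrite subrr normr0.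
have nk : (n + k)%N%:R * dt <= T.
  by apply: le_trans nkT; rewrite ler_pM2r// ler_nat addnS.
rewrite -natr1 mulrDl mul1r.
have [rn_ge0 rn_mass] := iter_positive_mass (n + k).
have var : abs_sum_le (fun j => r (n + k)%N (j + 1) - r (n + k)%N j)
    (variation_bound m V0 T T).
  apply: abs_sum_le_weaken (iter_variation (n + k)).
  have m0 := mass_ge0 r0_mass; have V00 := abs_sum_le_ge0 r0_var.
  rewrite lerBlDr -[leLHS]addr0 lerD// ler_wpM2r ?addr_ge0// ler_expR.
  by rewrite ler_wpM2l// growth_const_ge0.
apply: abs_sum_le_dom (abs_sum_leD (IHk nk)
  (step_displacement rn_ge0 rn_mass dt_le_T var)) => j.
rewrite addnS /= le_eqVlt; apply/orP; left; apply/eqP.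
by congr (`|_|); ring.
Qed.

End Iteration.
End OneStep.

(** * Translation invariance of the Lebesgue measure *)

Section Translation.
Variable R : realType.
Local Notation leb := (@lebesgue_measure R).

Lemma measurable_translation (c : R) :
  measurable_fun [set: R] (fun x : R => x + c).
Proof. exact: measurable_funD. Qed.

(** The image of the measure under a translation agrees with it on half-open
intervals, which determine it. *)
Lemma lebesgue_translation (c : R) (A : set (measurableTypeR R)) :
  measurable A -> leb A = leb ((fun x : R => x + c) @^-1` A).
Proof.
pose m := pushforward leb (fun x : R => x + c).
move=> mA; change (leb ((fun x : R => x + c) @^-1` A)) with (m A).
have : measurable_fun [set: measurableTypeR R]
    (fun x : measurableTypeR R => x + c : measurableTypeR R).
  exact: measurable_translation.
move=> mt.
apply: (@lebesgue_measure_unique R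
  (measure_function_pushforward__canonical__measure_function_Measure leb mt)) => //.
move=> _ [[a b] _ <-] /=.
rewrite /pushforward.
have -> : (fun x : R => x + c) @^-1` `]a, b] = [set` `]a - c, b - c]].
  by apply/seteqP; split=> x /=; rewrite !in_itv/= => /andP[? ?];
    apply/andP; split; lra.
rewrite !lebesgue_measure_itv/= !lte_fin ltrD2r.
by case: ifP => // _; rewrite -!EFinB; congr EFin; ring.
Qed.

Lemma integral_translation (c : R) (D : set R) (f : R -> \bar R) :
  measurable D -> measurable_fun [set: R] f -> (forall x, 0 <= f x)%E ->
  (\int[leb]_(x in D) f x
   = \int[leb]_(x in (fun x => (x + c)%R) @^-1` D) f (x + c)%R)%E.
Proof.
move=> mD mf f0.
have mfD : measurable_fun D f by exact: measurable_funS mf.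
have f0D : {in D, forall y, (0 <= f y)%E} by move=> *; exact: f0.
have mt : measurable_fun [set: measurableTypeR R]
    (fun x : measurableTypeR R => x + c : measurableTypeR R).
  exact: measurable_translation.
have := @ge0_integral_pushforward _ _ _ _ _ _ mt leb D f mD mfD f0D.
rewrite /comp => <-.
by apply: eq_measure_integral => A mA _; exact: lebesgue_translation.
Qed.

Lemma integrable_translation (c : R) (f : R -> R) :
  leb.-integrable [set: R] (EFin \o f) ->
  leb.-integrable [set: R] (EFin \o (fun x => f (x + c))).
Proof.
move=> /integrableP[mf fi]; apply/integrableP; split.
  by apply: (measurableT_comp mf); exact: measurable_translation.
apply: le_lt_trans fi.
rewrite (@integral_translation c setT (fun x => `|(f x)%:E|)%E)//.
exact: measurableT_comp.
Qed.

Lemma Rintegral_translation (c : R) (D : set R) (f : R -> R) :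
  measurable D -> leb.-integrable [set: R] (EFin \o f) ->
  \int[leb]_(x in D) f x =
  \int[leb]_(x in (fun x => x + c) @^-1` D) f (x + c).
Proof.
move=> mD fi; rewrite /Rintegral; congr fine.
have mt : measurable_fun [set: measurableTypeR R]
    (fun x : measurableTypeR R => x + c : measurableTypeR R).
  exact: measurable_translation.
have mpre : measurable ((fun x : measurableTypeR R => x + c) @^-1` D).
  by rewrite -[X in measurable X]setTI; exact: mt.
have /integrableP[mf _] := fi.
have fic : leb.-integrable ((fun x => x + c) @^-1` D)
    ((EFin \o f) \o (fun x : measurableTypeR R => x + c : measurableTypeR R)).
  by apply: integrableS (integrable_translation c fi).
have := @integral_pushforward _ _ _ _ _ _ mt leb D (EFin \o f) mf fic mD.
rewrite /comp => <-.
by apply: eq_measure_integral => A mA _; exact: lebesgue_translation.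
Qed.

Lemma ae_translation (c : R) (P : R -> Prop) :
  (\forall x \ae leb, P x) -> \forall x \ae leb, P (x + c).
Proof.
move=> [N [mN N0 PN]]; exists ((fun x => x + c) @^-1` N); split.
- rewrite -[X in measurable X]setTI; exact: measurable_translation.
- by rewrite -lebesgue_translation.
- by move=> x /= nP; apply: PN.
Qed.

Lemma ae_imply (P Q : R -> Prop) : (forall x, P x -> Q x) ->
  (\forall x \ae leb, P x) -> \forall x \ae leb, Q x.
Proof. exact: (@filterS _ _ (@ae_filter_ringOfSetsType _ _ R leb)). Qed.

Lemma ae_forall_int (P : int -> R -> Prop) :
  (forall j, \forall x \ae leb, P j x) -> \forall x \ae leb, forall j, P j x.
Proof.
move=> aeP.
have /ae_foralln : forall n : nat, \forall x \ae leb,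
    if unpickle n is Some j then P j x else True.
  by move=> n; case: unpickle => [j|]; [exact: aeP|exact: nearW].
by apply: filterS => x Px j; have := Px (pickle j); rewrite pickleK.
Qed.

End Translation.

(** * Piecewise constant functions and cell averages *)

Section Cells.
Variable R : realType.
Variable dx : R.
Hypothesis dx_gt0 : 0 < dx.
Local Notation leb := (@lebesgue_measure R).

Definition cell_index (x : R) : int := Num.floor (x / dx + 2^-1).

Lemma mem_cell j x : cell dx j x <-> cell_index x = j.
Proof.
have -> : (cell_index x = j) <-> (cell_index x == j) by split=> /eqP.
rewrite /cell_index floor_eq /cell /mesh_point /= in_itv/= intrD.
have -> : x / dx + 2^-1 = (x + dx / 2) / dx by field; rewrite gt_eqF.
rewrite ler_pdivlMr// ltr_pdivrMr// mulrDl mul1r.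
by split=> /andP[? ?]; apply/andP; split; lra.
Qed.

Lemma measurable_cell j : measurable (cell dx j).
Proof. exact: measurable_itv. Qed.

Lemma lebesgue_cell j : leb (cell dx j) = dx%:E.
Proof.
rewrite /cell lebesgue_measure_itv/= lte_fin.
move: (mesh_point dx j) => y; rewrite ifT; last by have := dx_gt0; lra.
by rewrite -EFinB; congr EFin; field.
Qed.

Lemma cell_translation j :
  (fun x => x + mesh_point dx j) @^-1` cell dx j = cell dx 0.
Proof.
apply/seteqP; split=> x /=; rewrite /cell /mesh_point /= !in_itv/= mul0r;
  move: (j%:~R * dx) => y; move=> /andP[? ?]; apply/andP; split; lra.
Qed.

Lemma integral_cell_function_le (g : int -> R) C : abs_sum_le g C ->
  (\int[leb]_x `|(g (cell_index x))%:E| <= (dx * C)%:E)%E.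
Proof.
move=> gC.
(* [pickle_inv] enumerates each index of a cell exactly once. *)
pose F (n : nat) : set R := if pickle_inv n is Some j then cell dx j else set0.
have mF n : measurable (F n).
  by rewrite /F; case: pickle_inv => // j; exact: measurable_cell.
have coverF : \bigcup_n F n = [set: R].
  rewrite -subTset => x _; exists (pickle (cell_index x)); first exact: I.
  by rewrite /F pickleK_inv; exact/mem_cell.
have tF : trivIset [set: nat] F.
  move=> n m _ _ [x []]; rewrite /F.
  have := @pickle_invK int n; have := @pickle_invK int m.
  case: pickle_inv => // i; case: pickle_inv => // j /= <- <-.
  by move=> /mem_cell <- /mem_cell <-.
have Fcst n x : F n x ->
    `|(g (cell_index x))%:E|%E = (oapp (fun j => `|g j|) 0 (pickle_inv n))%:E.
  by rewrite /F; case: pickle_inv => //= j /mem_cell ->.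
pose h (x : R) := `|(g (cell_index x))%:E|%E.
have mh : measurable_fun (\bigcup_n F n) h.
  apply/(measurable_fun_bigcup _ mF) => n.
  apply: (eq_measurable_fun (cst (oapp (fun j => `|g j|) 0 (pickle_inv n))%:E)).
    by move=> x /set_mem Fx; rewrite /h (Fcst n).
  exact: measurable_cst.
rewrite -coverF (@ge0_integral_bigcup _ _ _ leb F h mF mh _ tF); last first.
  by move=> x _; exact: abse_ge0.
have intF n : (\int[leb]_(x in F n) h x =
    (oapp (fun j => dx * `|g j|) 0 (pickle_inv n))%:E)%E.
  under eq_integral => x /set_mem Fx do rewrite /h (Fcst n)//.
  rewrite integral_cst; last exact: mF.
  rewrite /F; case: pickle_inv => [j|] /=; last by rewrite measure0 mule0.
  by rewrite lebesgue_cell -EFinM mulrC.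
apply: lime_le; first by apply: is_cvg_nneseries => n _ _;
  apply: integral_ge0 => x _; exact: abse_ge0.
apply: nearW => n; under eq_bigr do rewrite intF.
rewrite sumEFin lee_fin big_mkord -(big_mkord xpredT
  (fun i => oapp (fun j => dx * `|g j|) 0 (pickle_inv i))) /index_iota subn0.
rewrite -(big_pmap (op := +%R)) -mulr_sumr ler_pM2l//.
by apply: gC; apply: (pmap_uniq pickle_invK); exact: iota_uniq.
Qed.

Lemma sum_integral_cells_le (s : seq int) (f : R -> \bar R) : uniq s ->
  measurable_fun [set: R] f -> (forall x, 0 <= f x)%E ->
  (\sum_(j <- s) \int[leb]_(x in cell dx j) f x <= \int[leb]_x f x)%E.
Proof.
move=> us mf f0.
under eq_bigr do rewrite integral_mkcond.
have mfc (j : int) : measurable_fun [set: R] (f \_ (cell dx j)).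
  apply/(measurable_restrict _ (measurable_cell j) measurableT).
  exact: measurable_funTS.
have fc0 (j : int) x : (0 <= (f \_ (cell dx j)) x)%E.
  by rewrite /patch; case: ifP.
rewrite -ge0_integral_sum//.
apply: ge0_le_integral => //.
- by move=> x _; apply: sume_ge0.
- exact: emeasurable_sum.
move=> x _; have [xs|xs] := boolP (cell_index x \in s).
  rewrite (bigD1_seq (cell_index x))//= big1 ?adde0.
    by rewrite /patch; case: ifP.
  move=> j jx; rewrite /patch ifF//; apply/negbTE; apply: contraNN jx.
  by move=> /set_mem/mem_cell ->.
rewrite big1_seq// => j /andP[_ js]; rewrite /patch ifF//.
by apply/negP => /set_mem/mem_cell jx; rewrite jx js in xs.
Qed.

End Cells.

Section InitialData.
Variable R : realType.
Variable dx : R.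
Hypothesis dx_gt0 : 0 < dx.
Local Notation leb := (@lebesgue_measure R).

Lemma arithmetic_variation (v : R -> R) (y : R) (n : nat) :
  ((\sum_(0 <= k < n) `|v (y + k.+1%:R * dx) - v (y + k%:R * dx)|)%:E
    <= total_variation y (y + n%:R * dx) v)%E.
Proof.
elim: n => [|n IHn].
  by rewrite big_geq// total_variation_ge0// mul0r addr0.
have dx0 := ltW dx_gt0.
have le1 : y <= y + n%:R * dx by rewrite lerDl mulr_ge0.
have le2 : y + n%:R * dx <= y + n.+1%:R * dx.
  by rewrite lerD2l ler_wpM2r// ler_nat.
rewrite big_nat_recr//= (total_variationD v le1 le2) EFinD.
by apply: leeD => //; exact: total_variation_ge.
Qed.

(** The variation of [v] along any translate of the mesh is bounded by its total
variation, with no dependence on dx. *)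
Lemma mesh_variation (v : R -> R) V : (TV_line v <= V%:E)%E -> forall x,
  abs_sum_le
    (fun j => v (x + mesh_point dx (j + 1)) - v (x + mesh_point dx j)) V.
Proof.
move=> vV x s us.
pose n := \max_(j <- s) absz j.
apply: (@le_trans _ _ (\sum_(j <- int_window 0 n)
    `|v (x + mesh_point dx (j + 1)) - v (x + mesh_point dx j)|)).
  apply: ler_sum_subset => //; first exact: int_window_uniq.
  move=> j js; apply: mem_int_window; rewrite subr0.
  by rewrite /n (big_rem j)//= leq_maxl.
pose y := x - n%:R * dx.
rewrite big_map.
rewrite (eq_bigr (fun k : nat =>
    `|v (y + k.+1%:R * dx) - v (y + k%:R * dx)|)); last first.
  move=> k _; congr (`|v _ - v _|); rewrite /y /mesh_point !intrD mulrNz.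
    by rewrite -natr1 -!pmulrn; ring.
  by rewrite -!pmulrn; ring.
rewrite -lee_fin.
have := arithmetic_variation v y (n + n).+1; rewrite /index_iota subn0.
move=> /le_trans; apply; apply: le_trans vV.
apply: ereal_sup_ubound; exists (y, y + (n + n).+1%:R * dx) => //=.
by rewrite lerDl mulr_ge0// ltW.
Qed.

Variable rho0 : R -> R.
Hypothesis rho0_L1 : leb.-integrable [set: R] (EFin \o rho0).
Local Notation avg := (cell_average dx rho0).

Let measurable_rho0 : measurable_fun [set: R] (EFin \o rho0).
Proof. by case/integrableP: rho0_L1. Qed.

Lemma Rintegral_normE (D : set R) (h : R -> R) : measurable D ->
  leb.-integrable [set: R] (EFin \o h) ->
  ((\int[leb]_(x in D) `|h x|)%:E = \int[leb]_(x in D) `|(h x)%:E|)%E.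
Proof.
move=> mD hi; rewrite /Rintegral fineK//.
have hD : leb.-integrable D (EFin \o h) by exact: integrableS hi.
by apply: integrable_fin_num => //; exact: integrable_norm hD.
Qed.

Lemma cell_average_ge0 :
  (\forall x \ae leb, 0 <= rho0 x) -> forall j, 0 <= avg j.
Proof.
move=> rho0_ge0 j; rewrite /cell_average mulr_ge0 ?invr_ge0 ?(ltW dx_gt0)//.
rewrite /Rintegral fine_ge0//.
have -> : (\int[leb]_(x in cell dx j) (rho0 x)%:E
         = \int[leb]_(x in cell dx j) `|(rho0 x)%:E|)%E.
  apply: ae_eq_integral.
  - exact: measurable_cell.
  - exact: measurable_funTS.
  - by apply: measurable_funTS; exact: measurableT_comp.
  - by apply: ae_imply rho0_ge0 => x x0 _ /=; rewrite ger0_norm.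
by apply: integral_ge0 => x _; exact: abse_ge0.
Qed.

Lemma cell_average_mass :
  abs_sum_le avg (fine (\int[leb]_x `|(rho0 x)%:E|)%E / dx).
Proof.
move=> s us; rewrite mulrC -ler_pdivrMl ?invr_gt0// invrK mulr_sumr.
apply: (@le_trans _ _ (\sum_(j <- s) \int[leb]_(x in cell dx j) `|rho0 x|)).
  apply: ler_sum => j _; rewrite normrM gtr0_norm ?invr_gt0// mulVKf ?gt_eqF//.
  apply: le_normr_Rintegral; first exact: measurable_cell.
  by apply: integrableS rho0_L1 => //; exact: measurable_cell.
rewrite -lee_fin fineK; last first.
  have /integrableP[_ fin] := rho0_L1.
  by rewrite ge0_fin_numE// integral_ge0// => x _; exact: abse_ge0.
rewrite -sumEFin.
under eq_bigr do rewrite (Rintegral_normE (@measurable_cell _ _ _) rho0_L1).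
apply: (sum_integral_cells_le dx_gt0 us (f := fun x => `|(rho0 x)%:E|%E)) => //.
exact: measurableT_comp.
Qed.

Lemma cell_average_diff j : avg (j + 1) - avg j = dx^-1 *
  \int[leb]_(x in cell dx 0)
     (rho0 (x + mesh_point dx (j + 1)) - rho0 (x + mesh_point dx j)).
Proof.
have int_shift i : leb.-integrable (cell dx 0)
    (EFin \o (fun x => rho0 (x + mesh_point dx i))).
  by apply: integrableS (integrable_translation _ rho0_L1) => //;
    exact: measurable_cell.
rewrite RintegralB//; last exact: measurable_cell.
have avgE i : avg i =
    dx^-1 * \int[leb]_(x in cell dx 0) rho0 (x + mesh_point dx i).
  rewrite /cell_average; congr (_ * _).
  rewrite (Rintegral_translation (mesh_point dx i) (@measurable_cell _ _ _)
    rho0_L1).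
  by rewrite cell_translation.
by rewrite !avgE mulrBr.
Qed.

(** After translation of all cells to the one at the origin, the variation of the
averages is at most the average over x of the variation of [rho0] along the mesh
through x. For almost every x, [rho0] agrees with its representative [v] of
bounded variation at every point of this mesh. *)
Lemma cell_average_variation (v : R -> R) V : v = rho0 %[ae leb] ->
  (TV_line v <= V%:E)%E ->
  abs_sum_le (fun j => avg (j + 1) - avg j) V.
Proof.
move=> vrho vV s us.
pose D (j : int) (x : R) :=
  rho0 (x + mesh_point dx (j + 1)) - rho0 (x + mesh_point dx j).
have intD j : leb.-integrable [set: R] (EFin \o D j).
  have := integrableB measurableT
    (integrable_translation (mesh_point dx (j + 1)) rho0_L1)
    (integrable_translation (mesh_point dx j) rho0_L1).
  by apply: eq_integrable.
apply: (@le_trans _ _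
  (dx^-1 * \sum_(j <- s) \int[leb]_(x in cell dx 0) `|D j x|)).
  rewrite mulr_sumr; apply: ler_sum => j _.
  rewrite cell_average_diff normrM gtr0_norm ?invr_gt0// ler_pM2l ?invr_gt0//.
  apply: le_normr_Rintegral; first exact: measurable_cell.
  by apply: integrableS (intD j) => //; exact: measurable_cell.
rewrite ler_pdivrMl// -lee_fin -sumEFin.
under eq_bigr do rewrite (Rintegral_normE (@measurable_cell _ _ _) (intD _)).
have mD j : measurable_fun (cell dx 0) (fun x => `|(D j x)%:E|%E).
  apply: measurable_funTS; apply: measurableT_comp => //.
  by case/integrableP: (intD j).
rewrite -(ge0_integral_sum leb (measurable_cell dx 0) mD)//.
rewrite EFinM muleC -(lebesgue_cell dx_gt0 0) -integral_cst; last first.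
  exact: measurable_cell.
have V0 : 0 <= V := abs_sum_le_ge0 (mesh_variation vV 0).
apply: ae_ge0_le_integral => //.
- exact: measurable_cell.
- by move=> x _; apply: sume_ge0 => j _; exact: abse_ge0.
- exact: emeasurable_sum.
have vj : \forall x \ae leb, forall j,
    v (x + mesh_point dx j) = rho0 (x + mesh_point dx j).
  apply: ae_forall_int => j.
  apply: (@ae_translation _ _ (fun x => v x = rho0 x)).
  by apply: ae_imply vrho => x; apply.
apply: ae_imply vj => x vx _; rewrite /cst.
rewrite (eq_bigr (fun j =>
    (`|v (x + mesh_point dx (j + 1))
       - v (x + mesh_point dx j)|)%:E)); last first.
  by move=> j _; rewrite /D -!vx.
by rewrite sumEFin lee_fin; exact: (mesh_variation vV).
Qed.

End InitialData.

(** * Lipschitz continuity in time of the approximate solutions *)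

Lemma le_ereal_quotient (R : realType) (l c x : R) : 0 <= c ->
  (l%:E <= c%:E / x%:E)%E -> 0 <= x -> l * x <= c.
Proof.
move=> c0; rewrite inver; case: eqVneq => [->|xn0 + x0]; first by rewrite mulr0.
by rewrite -EFinM lee_fin ler_pdivlMr// lt0r xn0.
Qed.

Theorem theorem4p5 (R : realType) (f : R -> R -> R) (mu : R -> R)
    (f_C2 : C2_plane f)
    (f_rho_Linf : Linf_plane (d_rho f))
    (f_0 : forall a : R, f 0 a = 0)
    (f_A_bound : exists M : R, 0 < M /\
       forall r a : R,
         `|d_A f r a| <= M * `|r| /\ `|d_A (d_A f) r a| <= M * `|r|)
    (f_rho_W1inf : W1inf_plane (d_rho f))
    (mu_C2 : C2_line mu)
    (mu_supp : compact_support mu)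
    (mu_W2inf : W2inf_line mu)
    (theta alpha : R)
    (theta_itv : 0 <= theta <= 2^-1)
    (alpha_itv : 0 < alpha < 8 / 27)
    (rho0 : R -> R)
    (rho0_ge0 : \forall x \ae @lebesgue_measure R, 0 <= rho0 x)
    (rho0_Linf : rho0 \in Lfun (@lebesgue_measure R) +oo%E)
    (rho0_BV : BV_line rho0)
    (T : R) (T_gt0 : 0 < T)
    (lambda : R) (lambda_gt0 : 0 < lambda)
    (* [x / 0 = +oo] in [\bar R] for [0 < x] *)
    (CFL : let L := Linf_norm_plane (d_rho f) in
       (lambda%:E <= Order.min ((8 - 27 * alpha)%:E / (27%:E * L))
                       (Order.min (2%:E / (27%:E * L)) (alpha%:E / L)))%E) :
  exists kappa : R, forall dx dt : R, 0 < dx -> 0 < dt -> dt / dx = lambda ->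
    forall t1 t2 : R, 0 <= t1 <= T -> 0 <= t2 <= T ->
      ('N[@lebesgue_measure R]_1[(fun x =>
           (approx_solution f mu theta alpha dx dt rho0 t1 x
            - approx_solution f mu theta alpha dx dt rho0 t2 x)%:E)]
       <= (kappa * (`|t1 - t2| + dt))%:E)%E.
Proof.
have [C1f C1fr C1fA] := f_C2.
have [fr_fin _ frA_fin] := f_rho_W1inf.
have [M [M_gt0 fM]] := f_A_bound.
have fA_le r a : `|d_A f r a| <= M * `|r| by have [] := fM r a.
have fAA_le r a : `|d_A (d_A f) r a| <= M * `|r| by have [] := fM r a.
set L := fine (Linf_norm_plane (d_rho f)).
set K := fine (Linf_norm_plane (d_A (d_rho f))).
have L_ge0 : 0 <= L by rewrite fine_ge0// Lnorm_ge0.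
have K_ge0 : 0 <= K by rewrite fine_ge0// Lnorm_ge0.
have [B B_ge0 muB] := kernel_bounds mu_C2 mu_W2inf.
move/andP: (alpha_itv) => [alpha_gt0 alpha_lt].
move: CFL; rewrite /= (Linf_plane_norm_fin f_rho_Linf) -/L -EFinM !le_min.
move=> /and3P[CFL1 CFL2 CFL3].
have L27 : 0 <= 27 * L by rewrite mulr_ge0.
have c1 : lambda * (27 * L) <= 8 - 27 * alpha.
  by apply: le_ereal_quotient CFL1 L27; lra.
have c2 : lambda * (27 * L) <= 2 by exact: le_ereal_quotient CFL2 L27.
have c3 : lambda * L <= alpha by apply: le_ereal_quotient CFL3 L_ge0; lra.
have [rho0_L1 /ereal_inf_lt[_ [v vrho0 <-] TVv]] := rho0_BV.
move/Lfun1_integrable: rho0_L1 => rho0_int.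
set m := fine (\int[@lebesgue_measure R]_x `|(rho0 x)%:E|)%E.
set V := fine (TV_line v).
have vV : (TV_line v <= V%:E)%E.
  by rewrite /V; case: (TV_line v) TVv => [r| |] //= _; rewrite leNye.
pose D := displacement_const K M B lambda m V T.
(* One step moves the solution in L^1 by dx * D = (D / lambda) * dt. *)
exists (`|D| / lambda) => dx dt dx_gt0 dt_gt0 dtdx.
have dtE : dt = lambda * dx by rewrite -dtdx divfK// gt_eqF.
have [N muN] := kernel_support mu_supp dx_gt0.
pose r n := scheme f mu theta alpha dx dt rho0 n.
have r_lip n1 n2 : (n1 <= n2)%N -> n2%:R * dt <= T ->
    abs_sum_le (fun j => r n2 j - r n1 j) ((n2 - n1)%N%:R * `|D|).
  move=> n12 n2T; have [n2_0|n2_gt0] := posnP n2.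
    (* This case covers dt > T: no step is then completed before T. *)
    move: n12; rewrite n2_0 leqn0 => /eqP -> s _.
    by rewrite big1 ?mul0r// => j _; rewrite subrr normr0.
  have dt_le_T : dt <= T.
    by apply: le_trans n2T; rewrite ler_peMl ?(ltW dt_gt0)// ler1n.
  rewrite -{1}(subnKC n12).
  apply: abs_sum_le_weaken (ler_wpM2l (ler0n _ _) (ler_norm D)) _.
  rewrite /D -dtdx.
  apply: (@iter_time_lipschitz _ f mu theta alpha dx dt L K M B N) => //.
  - exact: ltW.
  - by rewrite dtdx; lra.
  - by rewrite dtdx; lra.
  - by rewrite dtdx.
  - exact: rho_lipschitz.
  - exact: A_lipschitz.
  - exact: mixed_lipschitz.
  - exact: A_second_difference.
  - by move=> j; have [] := muB dx dx_gt0 j.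
  - by move=> j; have [] := muB dx dx_gt0 j.
  - exact: cell_average_ge0.
  - exact: cell_average_mass.
  - exact: cell_average_variation vV.
  - by rewrite subnKC.
have ordered t1 t2 : 0 <= t1 -> t1 <= t2 -> t2 <= T ->
    (\int[@lebesgue_measure R]_x
       `|(approx_solution f mu theta alpha dx dt rho0 t2 x
          - approx_solution f mu theta alpha dx dt rho0 t1 x)%:E|
     <= (`|D| / lambda * ((t2 - t1) + dt))%:E)%E.
  move=> t1_ge0 t12 t2T.
  have dtV : 0 <= dt^-1 by rewrite invr_ge0 ltW.
  set n1 := Num.truncn (t1 / dt); set n2 := Num.truncn (t2 / dt).
  have n12 : (n1 <= n2)%N by apply: le_truncn; rewrite ler_wpM2r.
  have /andP[_ t1n] : n1%:R <= t1 / dt < n1.+1%:R.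
    by apply: truncn_itv; rewrite divr_ge0// ltW.
  have /andP[n2t _] : n2%:R <= t2 / dt < n2.+1%:R.
    by apply: truncn_itv; rewrite divr_ge0 ?(ltW dt_gt0)// (le_trans t1_ge0).
  rewrite ler_pdivlMr// in n2t; rewrite ltr_pdivrMr// in t1n.
  have := integral_cell_function_le dx_gt0 (r_lip _ _ n12 (le_trans n2t t2T)).
  move=> /le_trans; apply; rewrite lee_fin natrB//.
  have -> : dx * ((n2%:R - n1%:R) * `|D|)
      = `|D| / lambda * (n2%:R * dt - n1%:R * dt).
    by rewrite dtE; field; rewrite gt_eqF.
  rewrite ler_wpM2l ?divr_ge0 ?(ltW lambda_gt0)//.
  by move: t1n; rewrite -natr1 mulrDl mul1r; lra.
move=> t1 t2 /andP[t1_ge0 t1T] /andP[t2_ge0 t2T]; rewrite Lnorm1.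
have [t12|/ltW t21] := leP t1 t2.
  rewrite distrC (ger0_norm (x := t2 - t1)) ?subr_ge0//.
  apply: le_trans (ordered _ _ t1_ge0 t12 t2T).
  by rewrite le_eqVlt; apply/orP; left; apply/eqP; apply: eq_integral => x _;
    rewrite /= distrC.
by rewrite (ger0_norm (x := t1 - t2)) ?subr_ge0//; exact: ordered.
Qed.
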